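(* Let $p_1,p_2,p_3,p_4>0$ with $\sum_{l=1}^4p_l=1$ and $|p_1-p_3|+|p_2-p_4|\ne 0$, let $q=(p_1-p_3,\,p_2-p_4)'\in\mathbb{R}^2$, let $\alpha\in(0,\infty)$, and let $e\in\mathbb{R}^2$ be a point belonging to $h_0\mathbb{Z}^2$ for some $h_0>0$. The equation $$\frac{\partial\mu(t,x)}{\partial t}=-q\cdot\nabla\mu(t,x)+\alpha\,\delta_e,\quad (t,x)\in\mathbb{R}_+\times\mathbb{R}^2,\qquad \mu(0,x)=0,\quad x\in\mathbb{R}^2,$$ has a unique weak solution in $C([0,\infty):\mathbb{M})$, given by $$\mu(t,dx)=\alpha\int_0^t\delta_{e+qs}(dx)\,ds,\qquad t\ge 0.$$ Namely, $\mu=\{\mu(t,dx)\}_{t\ge0}$ given by this formula is the unique element of $C([0,\infty):\mathbb{M})$ such that $\mu(0,dx)=0$ and, for all $f\in C_0^1((0,\infty)\times\mathbb{R}^2)$, $$\int_{(0,\infty)\times\mathbb{R}^2}\frac{\partial f}{\partial t}(t,x)\,\mu(t,dx)\,dt+\int_{(0,\infty)\times\mathbb{R}^2}q\cdot\nabla f(t,x)\,\mu(t,dx)\,dt+\alpha\int_{(0,\infty)}f(t,e)\,dt=0.$$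
   Context: $\mathbb{M}$ is the space of finite (nonnegative) Borel measures on $\mathbb{R}^2$ with the topology of weak convergence (a Polish space under a suitable metric). $C([0,\infty):\mathbb{M})$ is the space of continuous functions from $[0,\infty)$ to $\mathbb{M}$ with the local uniform topology. $C_0^1((0,\infty)\times\mathbb{R}^2)$ is the space of real-valued continuously differentiable functions on $(0,\infty)\times\mathbb{R}^2$ with compact support. $\nabla$ is the gradient in $x\in\mathbb{R}^2$, and $\delta_y(dx)$ is the Dirac measure at $y\in\mathbb{R}^2$. *)

(* Defs.v *)
From HB Require Import structures.
From mathcomp Require Import all_boot all_order all_algebra.
From mathcomp Require Import all_classical all_reals all_analysis.

Set Implicit Arguments.
Unset Strict Implicit.
Unset Printing Implicit Defensive.

Import Order.TTheory GRing.Theory Num.Theory.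
Import numFieldNormedType.Exports.

Local Open Scope classical_set_scope.
Local Open Scope ring_scope.

(* [R * R] carrying the sigma-algebra generated by its open sets. *)
Definition borel_plane (R : realType) := g_sigma_algebraType (@open (R * R)%type).

Section finite_measures.
Variable R : realType.

(* Two elements represent the same Borel measure when they agree on every
   measurable set: the values of a library measure elsewhere are unconstrained,
   so Leibniz equality is too fine. *)
Definition finite_borel : Type := {finite_measure set (borel_plane R) -> \bar R}.

HB.instance Definition _ := gen_eqMixin finite_borel.
HB.instance Definition _ := gen_choiceMixin finite_borel.

Definition bounded_continuous : Type :=
  {g : R * R -> R | continuous g /\ bounded_fun g}.

HB.instance Definition _ := gen_eqMixin bounded_continuous.
HB.instance Definition _ := gen_choiceMixin bounded_continuous.

Definition test_integrals (m : finite_borel) : {ptws bounded_continuous -> R} :=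
  fun g => \int[m]_x sval g x.

(* Topology of weak convergence: the coarsest one making m |-> \int g dm
   continuous for every bounded continuous g. *)
HB.instance Definition _ :=
  Topological.copy finite_borel (initial_topology test_integrals).

End finite_measures.

Section weak_solutions.
Variable R : realType.
Implicit Types (f : R * (R * R) -> R) (q v e : R * R) (mu : R -> finite_borel R).

Definition dot v q : R := v.1 * q.1 + v.2 * q.2.

Definition partial_t f (z : R * (R * R)) : R := 'D_(1, (0, 0)) f z.

Definition grad_x f (z : R * (R * R)) : R * R :=
  ('D_(0, (1, 0)) f z, 'D_(0, (0, 1)) f z).

(* (0, oo) x R^2. *)
Definition spacetime : set (R * (R * R)) := [set z | 0 < z.1].

(* A function on (0, oo) x R^2 is represented by any extension of it; its
   support is the closure of its nonvanishing set relative to (0, oo) x R^2. *)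
Definition C1_compact f : Prop :=
  [/\ {in spacetime, forall z, differentiable f z},
      {in spacetime, continuous (partial_t f)},
      {in spacetime, continuous (grad_x f)} &
      compact (spacetime `&` closure (spacetime `&` [set z | f z != 0]))].

Definition weak_solution q (alpha : R) e mu : Prop :=
  [/\ {within [set t | 0 <= t], continuous mu},
      forall A, measurable A -> mu 0 A = 0%E &
      forall f, C1_compact f ->
        (\int[lebesgue_measure]_(t in `]0%R, +oo[)
            \int[mu t]_x (partial_t f (t, x))%:E
         + \int[lebesgue_measure]_(t in `]0%R, +oo[)
            \int[mu t]_x (dot q (grad_x f (t, x)))%:E
         + alpha%:E * \int[lebesgue_measure]_(t in `]0%R, +oo[) (f (t, e))%:E
         = 0)%E].

End weak_solutions.

(* Main.v *)
Require Import Defs.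
From HB Require Import structures.
From mathcomp Require Import all_boot all_order all_algebra.
From mathcomp Require Import all_classical all_reals all_analysis.
From mathcomp Require Import measurable_realfun.
From mathcomp Require Import ring lra.

(** Why the theorem holds.  The measure alpha * int_0^t delta_{e + qs} ds is
    alpha times the image of Lebesgue measure on [0, t] under the ray
    s |-> e + sq, so integrals against it are integrals along that ray.

    Existence.  For a test function f the three terms of the weak equation can
    be computed separately.  Fubini and the fundamental theorem of calculus in
    t turn the first one, the integral of the t-derivative of f over
    0 < s < t at the points (t, e + qs), into - alpha int f(s, e + qs) ds
    (fubini_time_derivative).  Along the ray, q . grad f is the derivative of
    s |-> f(t, e + qs), so the second term is
    alpha int (f(t, e + qt) - f(t, e)) dt (integral_drift_along_ray).  The
    third term cancels what is left (occupation_weak_solution).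

    Uniqueness.  Observed in the frame moving with velocity q the equation has
    no transport.  For f(t, x) = phi(t) g(x - qt) the equation only involves
    N(t) = int g(x - qt) nu_t(dx), in the form
    int phi' N + alpha int phi(t) g(e - qt) dt = 0
    (weak_solution_travelling).  Weak continuity of nu makes N continuous on
    [0, oo) (continuous_shifted_integral), with N(0) = 0.  For two solutions
    the difference G of the functions N satisfies int phi' G = 0 for every
    phi, hence is constant (du_bois_reymond), hence vanishes.  Letting g
    increase to the indicator of an open rectangle, the two solutions agree on
    all open rectangles at each time, and these form a pi-system generating the
    Borel sets of the plane (finite_borel_eq). *)

Set Implicit Arguments.
Unset Strict Implicit.
Unset Printing Implicit Defensive.

Import Order.TTheory GRing.Theory Num.Theory.
Import numFieldNormedType.Exports.

Local Open Scope classical_set_scope.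
Local Open Scope ring_scope.

(** * Open rectangles and the Borel sets of the plane *)

Definition open_rects (R : realType) : set (set (R * R)) :=
  [set A | exists a b c d : R, A = `]a, b[ `*` `]c, d[].
Arguments open_rects : clear implicits.

(** Rectangles with rational corners that lie inside U cover it, and there are
    countably many of them. *)
Lemma open_bigcup_rects (R : realType) (U : set (R * R)) : open U ->
  exists2 F : nat -> set (R * R), forall n, open_rects R (F n) &
    U = \bigcup_n F n.
Proof.
move=> oU.
pose box (i : (rat * rat) * (rat * rat)) : set (R * R) :=
  `](ratr i.1.1 : R), ratr i.1.2[ `*` `](ratr i.2.1 : R), ratr i.2.2[.
(* the empty set, itself a degenerate rectangle, fills the unused codes *)
pose F (n : nat) : set (R * R) := if unpickle n is Some i then
  (if `[< box i `<=` U >] then box i else set0) else set0.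
exists F => [n|].
  rewrite /F; case: unpickle => [i|]; last first.
    by exists 0, 0, 0, 0; rewrite set_itvoo0 ?setX0.
  case: ifP => _; first by do 4 eexists.
  by exists 0, 0, 0, 0; rewrite set_itvoo0 ?setX0.
apply/seteqP; split => [[x y] Uxy|p [n _]]; last first.
  by rewrite /F; case: unpickle => [i|]//; case: ifPn => // /asboolP; exact.
have /nbhs_ballP[r /= r0 rU] : nbhs (x, y) U by exact: open_nbhs_nbhs.
have rat_near (u v : R) : u < v -> exists2 p : rat, u < ratr p & ratr p < v.
  by move=> uv; have [p] := rat_in_itvoo uv; rewrite in_itv/= => /andP[]; exists p.
have [a1 ? ?] := rat_near (x - r) x ltac:(by rewrite ltrBlDr ltrDl).
have [b1 ? ?] := rat_near x (x + r) ltac:(by rewrite ltrDl).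
have [a2 ? ?] := rat_near (y - r) y ltac:(by rewrite ltrBlDr ltrDl).
have [b2 ? ?] := rat_near y (y + r) ltac:(by rewrite ltrDl).
exists (pickle ((a1, b1), (a2, b2))); first exact: I.
rewrite /F pickleK.
case: asboolP => [_|[]]; first by split; rewrite /= in_itv/=; apply/andP.
move=> [u v] [/=]; rewrite !in_itv/= => /andP[? ?] /andP[? ?]; apply: rU.
by split => /=; rewrite /ball/= ltr_norml; apply/andP; split; lra.
Qed.

Lemma measurable_open_rects (R : realType) (A : set (borel_plane R)) :
  open_rects R A -> measurable A.
Proof.
move=> [a [b [c [d ->]]]]; apply: sub_sigma_algebra.
rewrite (_ : _ `*` _ = fst @^-1` `]a, b[ `&` snd @^-1` `]c, d[); last first.
  by apply/seteqP; split.
apply: openI; apply: open_comp; try exact: interval_open.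
- by move=> p _; exact: cvg_fst.
- by move=> p _; exact: cvg_snd.
Qed.

(** Countable unions suffice to reach every open set, so the open rectangles,
    which unlike the open sets can be tested with products of bumps, generate
    the same sigma-algebra. *)
Lemma borel_plane_rects (R : realType) :
  @measurable _ (borel_plane R) = <<s open_rects R >>.
Proof.
apply/seteqP; split; apply: smallest_sub.
- exact: smallest_sigma_algebra.
- move=> U /open_bigcup_rects[F oF ->].
  apply: sigma_algebra_bigcup => n.
  exact: sub_sigma_algebra.
- exact: sigma_algebra_measurable.
- by move=> A /measurable_open_rects.
Qed.

Lemma open_rects_setI (R : realType) : setI_closed (open_rects R).
Proof.
move=> _ _ [a [b [c [d ->]]]] [a' [b' [c' [d' ->]]]].
exists (Num.max a a'), (Num.min b b'), (Num.max c c'), (Num.min d d').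
apply/seteqP; split => [[x y]|[x y]] /=; rewrite !in_itv/= !gt_max !lt_min.
  by move=> [[/andP[-> ->] /andP[-> ->]] [/andP[-> ->] /andP[-> ->]]].
by move=> [/andP[/andP[-> ->] /andP[-> ->]] /andP[/andP[-> ->] /andP[-> ->]]].
Qed.

(** Dynkin's pi-lambda argument; finiteness makes the squares ]-n, n[^2 an
    exhaustion of finite mass. *)
Lemma finite_borel_eq (R : realType) (m1 m2 : finite_borel R) :
  (forall a b c d : R, m1 (`]a, b[ `*` `]c, d[) = m2 (`]a, b[ `*` `]c, d[)) ->
  forall A, measurable A -> m1 A = m2 A.
Proof.
move=> m12 A mA.
pose g (n : nat) : set (borel_plane R) :=
  `](- n%:R : R), n%:R[ `*` `](- n%:R : R), n%:R[.
have mg n : measurable (g n) by apply: measurable_open_rects; do 4 eexists.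
pose k1 : {finite_measure set (borel_plane R) -> \bar R} := m1.
pose k2 : {finite_measure set (borel_plane R) -> \bar R} := m2.
apply: (@measure_unique _ R (borel_plane R) (open_rects R) g _ _ _ _ k1 k2) => //.
- exact: borel_plane_rects.
- exact: open_rects_setI.
- by move=> n; do 4 eexists.
- apply/seteqP; split => // -[x y] _.
  have [n xyn] : exists n : nat, Num.max `|x| `|y| < n%:R.
    by exists (Num.bound (Num.max `|x| `|y|)); rewrite archi_boundP// le_max normr_ge0.
  exists n => //; split => /=; rewrite in_itv/= -ltr_norml;
    by apply: le_lt_trans xyn; rewrite le_max lexx ?orbT.
- by move=> B [a [b [c [d ->]]]]; exact: m12.
- by move=> n; rewrite ltey_eq fin_num_measure.
Qed.

(** Needed for Fubini: the Borel sets of the plane are measurable for the product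
    of the sigma-algebras of the two axes. *)
Lemma open_measurable_prod (R : realType) (U : set (R * R)) :
  open U -> measurable U.
Proof.
move=> /open_bigcup_rects[F oF ->]; apply: bigcup_measurable => n _.
by have [a [b [c [d ->]]]] := oF n; exact: measurableX.
Qed.

Lemma continuous_borel_plane (R : realType) (h : R * R -> R) :
  continuous h -> measurable_fun [set: borel_plane R] h.
Proof.
move=> ch.
apply: (measurability _ (RGenOpens.measurableE R)) => _ [_ [a [b ->]] <-].
rewrite setTI; apply: sub_sigma_algebra.
by apply: open_comp => // *; exact: ch.
Qed.

Lemma measurable_continuous_in (R : realType) (D : set (R * R)) (U : set (R * R))
    (h : R * R -> R) : measurable D -> open U -> D `<=` U ->
  {in U, continuous h} -> measurable_fun D h.
Proof.
move=> mD oU DU ch.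
apply: (measurability _ (RGenOpens.measurableE R)) => _ [_ [a [b ->]] <-].
rewrite -(setIidl DU) -setIA; apply: measurableI => //.
apply: open_measurable_prod; rewrite openE => x [Ux hx] /=.
apply: filterI; first exact: open_nbhs_nbhs.
apply: (ch x (mem_set Ux)); apply: open_nbhs_nbhs; split => //.
Qed.

(** * The occupation measure of a ray *)

Lemma continuous_pair (T U V : topologicalType) (f : T -> U) (g : T -> V)
    (x : T) :
  {for x, continuous f} -> {for x, continuous g} ->
  {for x, continuous (fun y => (f y, g y))}.
Proof. by move=> cf cg; exact: (cvg_pair cf cg). Qed.

Definition ray (R : realType) (e q : R * R) (s : R) : R * R :=
  (e.1 + s * q.1, e.2 + s * q.2).

Lemma continuous_ray (R : realType) (e q : R * R) : continuous (ray e q).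
Proof.
move=> s.
apply: (@continuous_pair R R R (fun s => e.1 + s * q.1) (fun s => e.2 + s * q.2));
  (apply: cvgD; first exact: cvg_cst).
- by apply: cvgM; [exact: cvg_id|exact: cvg_cst].
- by apply: cvgM; [exact: cvg_id|exact: cvg_cst].
Qed.

Lemma measurable_ray (R : realType) (e q : R * R) :
  measurable_fun setT (ray e q : measurableTypeR R -> borel_plane R).
Proof.
apply: (@measurability _ _ (measurableTypeR R) (borel_plane R) setT _
  (@open (R * R)%type) erefl) => _ [U oU <-].
have oV : open ((ray e q : R -> R * R) @^-1` U).
  by apply: open_comp => // s _; exact: continuous_ray.
by rewrite setTI; exact: open_measurable oV.
Qed.

(** The image measure as a bundled measure, with the measurability of the ray
    discharged once and for all. *)
Lemma ray_pushforward (R : realType) (e q : R * R)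
    (k : {measure set (measurableTypeR R) -> \bar R}) :
  exists p : {measure set (borel_plane R) -> \bar R}, p =
    pushforward k (ray e q : measurableTypeR R -> borel_plane R) :> (_ -> _).
Proof.
pose p := pushforward k (ray e q : measurableTypeR R -> borel_plane R).
unshelve eexists (p : {measure set (borel_plane R) -> \bar R}) => //.
exact: measurable_ray.
Qed.

(** alpha times the time spent in A by the ray up to time t.  It is a property of
    m because only the values on measurable sets are determined. *)
Definition occupation (R : realType) (alpha : R) (e q : R * R) (t : R)
    (m : finite_borel R) : Prop :=
  forall A, measurable A ->
    m A = (alpha%:E * lebesgue_measure (`[0%R, t] `&` ray e q @^-1` A))%E.

Lemma occupation_exists (R : realType) (alpha : R) (e q : R * R) (t : R) :
  0 <= alpha -> exists m, occupation alpha e q t m.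
Proof.
move=> a0.
have m0t : measurable (`[0, t]%classic : set (measurableTypeR R)) by [].
pose k : {measure set (measurableTypeR R) -> \bar R} :=
  mrestr (@lebesgue_measure R) m0t.
have [p pE] := ray_pushforward e q k.
pose m := mscale (NngNum a0) p.
have fm : fin_num_fun m.
  move=> A mA; rewrite /m /mscale/= fin_numM// pE /pushforward /k/= /mrestr.
  rewrite ge0_fin_numE// (@le_lt_trans _ _ (lebesgue_measure `[0%R, t]))//.
    apply: le_measure; rewrite ?inE//.
    apply: measurableI => //; rewrite -[X in measurable X]setTI.
    exact: measurable_ray.
  by rewrite lebesgue_measure_itv/=; case: ifP => _; rewrite ?ltry// -EFinD ltry.
pose fin := Measure_isFinite.Build _ _ _ m fm.
pose mf : {finite_measure set (borel_plane R) -> \bar R} := HB.pack m fin.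
exists mf => A mA; rewrite /mf/= /m /mscale/= pE /pushforward /k/= /mrestr.
by rewrite setIC.
Qed.

(** Restricting the measure to D or the integral to D is the same: the complement
    of D is null for the restricted measure. *)
Lemma integral_mrestr d (T : measurableType d) (R : realType)
    (mu : {measure set T -> \bar R}) (D : set T) (mD : measurable D)
    (f : T -> \bar R) : measurable_fun setT f ->
  (\int[mrestr mu mD]_x f x = \int[mu]_(x in D) f x)%E.
Proof.
move=> mf; rewrite -(setUv D) integral_setU//=; last 3 first.
- exact: measurableC.
- by rewrite setUv.
- by rewrite disj_set2E setICr.
rewrite [X in (_ + X)%E]null_set_integral ?adde0//=; last 3 first.
- exact: measurableC.
- exact: measurable_funTS.
- by rewrite /mrestr setICl measure0.
apply: (eq_measure_integral mu) => A mA AD.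
by rewrite /= /mrestr setIidl.
Qed.

Lemma integral_mscale d (T : measurableType d) (R : realType)
    (mu : {measure set T -> \bar R}) (k : {nonneg R})
    (f : T -> \bar R) : measurable_fun setT f -> mu.-integrable setT f ->
  (\int[mscale k mu]_x f x = k%:num%:E * \int[mu]_x f x)%E.
Proof.
move=> mf intf; have intp := integrable_pos_fin_num measurableT intf.
rewrite [LHS]integralE [X in _ = (_ * X)%E]integralE muleBr ?fin_num_adde_defr//.
by congr (_ - _)%E; rewrite ge0_integral_mscale//;
  [exact: measurable_funepos|exact: measurable_funeneg].
Qed.

Lemma integral_occupation (R : realType) (alpha : R) (e q : R * R) (t : R)
    (m : finite_borel R) (h : R * R -> R) : 0 <= alpha ->
    occupation alpha e q t m -> continuous h ->
  (\int[m]_x (h x)%:E =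
   alpha%:E * \int[lebesgue_measure]_(s in `[0%R, t]) (h (ray e q s))%:E)%E.
Proof.
move=> a0 mE ch.
have m0t : measurable (`[0, t]%classic : set (measurableTypeR R)) by [].
pose k : {measure set (measurableTypeR R) -> \bar R} :=
  mrestr (@lebesgue_measure R) m0t.
have [p pE] := ray_pushforward e q k.
have chr : continuous (h \o ray e q).
  by move=> s; apply: continuous_comp; [exact: continuous_ray|exact: ch].
have mhE : measurable_fun [set: borel_plane R] (EFin \o h).
  by apply/measurable_EFinP; exact: continuous_borel_plane.
have mhr : measurable_fun [set: measurableTypeR R] (EFin \o (h \o ray e q)).
  by apply/measurable_EFinP; exact: continuous_measurable_fun.
have ihr : lebesgue_measure.-integrable `[0, t] (EFin \o (h \o ray e q)).
  apply: continuous_compact_integrable; first exact: segment_compact.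
  exact: continuous_subspaceT.
have ikr : k.-integrable setT (EFin \o (h \o ray e q)).
  apply/integrableP; split => //.
  rewrite /k integral_mrestr//; first by have /integrableP[] := ihr.
  by apply: measurableT_comp.
have ip : p.-integrable setT (EFin \o h).
  rewrite pE.
  by apply: integrable_pushforward => //; exact: measurable_ray.
rewrite (eq_measure_integral (mscale (NngNum a0) p)); last first.
  move=> A mA _; apply: (eq_trans (mE A mA)).
  change (alpha%:E * lebesgue_measure (`[0%R, t] `&` ray e q @^-1` A) = alpha%:E * p A)%E.
  by rewrite pE /pushforward /k/= /mrestr setIC.
rewrite (integral_mscale _ mhE)//=; congr (_ * _)%E.
rewrite pE integral_pushforward//; last exact: measurable_ray.
by rewrite preimage_setT /k integral_mrestr.
Qed.

Lemma occupation_dirac (R : realType) (alpha : R) (e q : R * R) (t : R)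
    (m : finite_borel R) : occupation alpha e q t m ->
  forall A, measurable A ->
  (m A = alpha%:E * \int[lebesgue_measure]_(s in `[0%R, t])
              \d_((e.1 + s * q.1, e.2 + s * q.2)%R : borel_plane R) A)%E.
Proof.
move=> mE A mA; rewrite mE//; congr (_ * _)%E.
under eq_integral => s _ do rewrite diracE.
rewrite (_ : (fun s => _) = (fun s => (\1_(ray e q @^-1` A) s)%:E)); last first.
  by apply/funext => s; rewrite indicE; congr (_%:R%:E).
rewrite integral_indic//; first by rewrite setIC.
by rewrite -[X in measurable X]setTI; exact: measurable_ray.
Qed.

(** * Weak continuity *)

(** The topology of weak convergence is initial for the map sending a measure to
    its integrals, into a product of copies of the real line, so continuity is
    checked one bounded continuous function at a time. *)
Lemma weak_continuousP (R : realType) (mu : R -> finite_borel R) (D : set R) :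
  {within D, continuous mu} <->
  forall g : bounded_continuous R,
    {within D, continuous (fun t => \int[mu t]_x sval g x : R)}.
Proof.
split => [cmu g t|cmu].
- have cg : continuous (fun m : finite_borel R => test_integrals m g).
    move=> m.
    exact: (cvg_comp _ _ (@initial_continuous _ _ (@test_integrals R) m)
      (@proj_continuous (bounded_continuous R) (fun=> (R : topologicalType)) g _)).
  exact: (cvg_comp _ _ (cmu t) (cg (mu t))).
- apply: continuous_comp_initial => t; apply/cvg_sup => g.
  move=> U [_ [[V oV <-] /= Vt VU]]; apply: filterS VU _.
  by apply: (cmu g t); exact: open_nbhs_nbhs.
Qed.

(** The integral of g is alpha times the primitive of s |-> g (e + sq). *)
Lemma occupation_continuous (R : realType) (alpha : R) (e q : R * R)
    (mu : R -> finite_borel R) : 0 <= alpha ->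
    (forall t, occupation alpha e q t (mu t)) ->
  {within [set t | 0 <= t], continuous mu}.
Proof.
move=> a0 mE; apply/weak_continuousP => g; have [cg _] := svalP g.
have chr : continuous (sval g \o ray e q).
  by move=> s; apply: continuous_comp; [exact: continuous_ray|exact: cg].
have ihr a b : lebesgue_measure.-integrable `[a, b] (EFin \o (sval g \o ray e q)).
  apply: continuous_compact_integrable; first exact: segment_compact.
  exact: continuous_subspaceT.
have -> : (fun t => \int[mu t]_x sval g x) =
    (fun t => alpha * parameterized_integral lebesgue_measure 0 t (sval g \o ray e q)).
  apply/funext => t; rewrite /Rintegral (integral_occupation a0 (mE t) cg).
  by rewrite fineM//; exact: integrable_fin_num (ihr _ _).
apply/subspace_continuousP => t /= t0; apply: cvgM; first exact: cvg_cst.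
have t1 : 0 <= t + 1 by rewrite addr_ge0.
have /subspace_continuousP := parameterized_integral_continuous t1 (ihr 0 (t + 1)).
move=> /(_ t) H; apply: cvg_trans (H _); last first.
  by rewrite /= in_itv/= t0 lerDl ler01.
move=> U /=; rewrite !nbhs_simpl/= => HU.
have tt1 : \forall x \near t, x < t + 1.
  by apply: lt_nbhsl; rewrite ltrDl.
move: HU; rewrite /within/=; apply: filterS2 tt1 => x xt1 HUx x0.
by apply: HUx; rewrite in_itv/= x0 ltW.
Qed.

(** * Integrals over the half-line *)

Lemma integral_halfline (R : realType) (F : R -> R) (a b : R) : 0 < a ->
    (forall t, 0 < t -> {for t, continuous F}) ->
    (forall t, 0 < t -> (t < a) || (b < t) -> F t = 0) ->
  lebesgue_measure.-integrable `]0%R, +oo[ (EFin \o F) /\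
  (\int[lebesgue_measure]_(t in `]0%R, +oo[) (F t)%:E =
   \int[lebesgue_measure]_(t in `[a, b]) (F t)%:E)%E.
Proof.
move=> a0 cF F0.
have FE : (EFin \o F) \_ `]0, +oo[ = (EFin \o F) \_ `[a, b].
  apply/funext => t; rewrite !patchE; case: ifPn; case: ifPn => //.
  - rewrite notin_setE inE/= !in_itv/= andbT => tab t0; rewrite F0//.
    by move/negP : tab; rewrite negb_and -!ltNge.
  - rewrite notin_setE inE/= !in_itv/= andbT => /andP[/(lt_le_trans a0) -> _].
    by move=> /negP.
have iF : lebesgue_measure.-integrable `[a, b] (EFin \o F).
  apply: continuous_compact_integrable; first exact: segment_compact.
  apply/subspace_continuousP => t /=; rewrite in_itv/= => /andP[/(lt_le_trans a0) t0 _].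
  by apply: cvg_within_filter; exact: cF.
split.
  apply: (iffRL (@integrable_mkcond _ (measurableTypeR R) R _ _ _ _)) => //.
  by rewrite FE; apply: (iffLR (@integrable_mkcond _ (measurableTypeR R) R _ _ _ _)).
by rewrite integral_mkcond [RHS]integral_mkcond FE.
Qed.

(** The fundamental theorem on [s, c], with c beyond the point from which F
    and f vanish. *)
Lemma integral_deriv_tail (R : realType) (F f : R -> R) (s b : R) : 0 < s ->
    (forall t : R, 0 < t -> is_derive t (1 : R) F (f t)) ->
    (forall t, 0 < t -> {for t, continuous f}) ->
    (forall t, 0 < t -> b < t -> F t = 0 /\ f t = 0) ->
  (\int[lebesgue_measure]_(t in `[s, +oo[) (f t)%:E = (- F s)%:E)%E.
Proof.
move=> s0 dF cf Fb; pose c := Num.max (s + 1) (b + 1).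
have sc : s < c by rewrite lt_max ltrDl ltr01.
have bc : b < c by rewrite lt_max ltrDl ltr01 orbT.
have c0 := lt_trans s0 sc.
have cF t : 0 < t -> {for t, continuous F}.
  move=> t0; apply/differentiable_continuous/derivable1_diffP.
  by have [] := dF t t0.
have -> : (\int[lebesgue_measure]_(t in `[s, +oo[) (f t)%:E =
    \int[lebesgue_measure]_(t in `[s, c]) (f t)%:E)%E.
  rewrite integral_mkcond [RHS]integral_mkcond; congr integral.
  apply/funext => t; rewrite !patchE; case: ifPn; case: ifPn => //.
  - rewrite notin_setE inE/= !in_itv/= andbT => tab st.
    have [||_ -> //] := Fb t; first exact: lt_le_trans st.
    by move/negP : tab; rewrite st/= -ltNge; exact: lt_trans.
  - by rewrite notin_setE inE/= !in_itv/= andbT => /andP[-> _].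
rewrite (@continuous_FTC2 _ f F)//; last 3 first.
- apply/subspace_continuousP => t /=; rewrite in_itv/= => /andP[/(lt_le_trans s0) t0 _].
  by apply: cvg_within_filter; exact: cf.
- split.
  + move=> t; rewrite in_itv/= => /andP[/(lt_trans s0) t0 _].
    by have [] := dF t t0.
  + by apply: cvg_at_right_filter; exact: cF.
  + by apply: cvg_at_left_filter; exact: cF.
- move=> t; rewrite in_itv/= => /andP[/(lt_trans s0) t0 _].
  by rewrite derive1E; have [] := dF t t0.
by have [-> _] := Fb c c0 bc; rewrite -EFinB sub0r.
Qed.

(** * Test functions on space-time *)

(** Both difference quotients are the same function of the increment; this
    reduces partial derivatives to derivatives of functions of one variable. *)
Lemma is_derive_line (R : realType) (V : normedModType R) (f : V -> R)
    (c v : V) (s : R) :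
  differentiable f (c + s *: v) ->
  is_derive s (1 : R) (fun u => f (c + u *: v)) ('D_v f (c + s *: v)).
Proof.
move=> df; have := @diff_derivable _ _ _ f (c + s *: v) v df.
have E : (fun h : R => h^-1 *: (((fun u => f (c + u *: v)) \o shift s) (h *: (1 : R)) -
                          f (c + s *: v))) =
    (fun h : R => h^-1 *: ((f \o shift (c + s *: v)) (h *: v) - f (c + s *: v))).
  apply/funext => h /=; congr (_ *: (f _ - _)).
  by rewrite scaler1 scalerDl addrCA.
by move=> dv; apply: DeriveDef; rewrite /derivable /derive E.
Qed.

Lemma is_derive_time (R : realType) (f : R * (R * R) -> R) (t : R) (x : R * R) :
  differentiable f (t, x) ->
  is_derive t (1 : R) (fun u => f (u, x)) (partial_t f (t, x)).
Proof.
have E u : (u, x) = (0, x) + u *: (1, (0, 0)) :> R * (R * R).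
  by apply: injective_projections => /=; [rewrite add0r scaler1|
    apply: injective_projections; rewrite /= scaler0 addr0].
rewrite /partial_t E => df.
under [X in is_derive _ _ X]funext => u do rewrite E.
exact: is_derive_line.
Qed.

Lemma is_derive_ray (R : realType) (f : R * (R * R) -> R) (t s : R) (e q : R * R) :
  differentiable f (t, ray e q s) ->
  is_derive s (1 : R) (fun u => f (t, ray e q u)) (dot q (grad_x f (t, ray e q s))).
Proof.
have E u : (t, ray e q u) = (t, e) + u *: (0, q) :> R * (R * R).
  by apply: injective_projections => /=; [rewrite scaler0 addr0|
    apply: injective_projections].
rewrite E => df.
under [X in is_derive _ _ X]funext => u do rewrite E.
have -> : dot q (grad_x f ((t, e) + s *: (0, q))) = 'D_(0, q) f ((t, e) + s *: (0, q)).
  move: ((t, e) + _) df => z df; rewrite /dot /grad_x /= !deriveE//.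
  have -> : (0, q) = q.1 *: (0, (1, 0)) + q.2 *: (0, (0, 1)) :> R * (R * R).
    apply: injective_projections; rewrite /= ?scaler0 ?addr0//.
    by apply: injective_projections;
      rewrite /= ?scaler0 ?addr0 ?add0r scaler1.
  by rewrite linearD !linearZ/=.
exact: is_derive_line.
Qed.

Lemma open_spacetime (R : realType) : open (@spacetime R).
Proof.
apply: (@open_comp _ _ fst [set t : R | 0 < t]); last exact: open_gt.
by move=> z _; exact: cvg_fst.
Qed.

(** Outside its relative support f vanishes on a whole neighbourhood, because
    space-time is open. *)
Lemma C1_compact_out (R : realType) (f : R * (R * R) -> R) (z : R * (R * R)) :
  0 < z.1 -> ~ (@spacetime R `&` closure (@spacetime R `&` [set z | f z != 0])) z ->
  f z = 0 /\ forall v, 'D_v f z = 0.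
Proof.
move=> z0 zK.
have fz : \near z, f z = cst 0 z.
  have : nbhs z (@spacetime R `&` ~` closure (@spacetime R `&` [set z | f z != 0])).
    apply: filterI; first by apply: open_nbhs_nbhs; split => //; exact: open_spacetime.
    apply: open_nbhs_nbhs; split; first exact/closed_openC/closed_closure.
    by move=> zc; apply: zK.
  apply: filterS => w [w0 wc]; apply/eqP; apply: contrapT => /negP fw.
  by apply: wc; exact: subset_closure.
split; first exact: nbhs_singleton fz.
by move=> v; rewrite (near_eq_derive _ fz) derive_cst.
Qed.

(** The support is a compact subset of the open half-space t > 0, so the time
    coordinate attains a positive minimum and a maximum on it. *)
Lemma C1_compact_time (R : realType) (f : R * (R * R) -> R) : C1_compact f ->
  exists a b : R, 0 < a /\ forall z : R * (R * R), 0 < z.1 -> (z.1 < a) || (b < z.1) ->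
    f z = 0 /\ forall v, 'D_v f z = 0.
Proof.
case=> _ _ _; set K := _ `&` _ => cK.
have [K0|/set0P K0] := eqVneq K set0.
  exists 1, 0; split => // z z0 _; apply: C1_compact_out => //.
  by rewrite -/K K0.
have c1 : {within K, continuous (fst : R * (R * R) -> R)}.
  by apply: continuous_subspaceT => z; exact: cvg_fst.
have [zm Km zmP] := compact_EVT_min K0 cK c1.
have [zM KM zMP] := compact_EVT_max K0 cK c1.
exists zm.1, zM.1; split; first by move: Km; rewrite inE => -[].
move=> z z0 zab; apply: C1_compact_out => // Kz.
move: zab; rewrite !ltNge zmP ?inE// zMP ?inE//.
Qed.

Lemma C1_compact_partial_bounded (R : realType) (f : R * (R * R) -> R) :
  C1_compact f -> exists M : R, forall z : R * (R * R), 0 < z.1 -> `|partial_t f z| <= M.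
Proof.
case=> _ cf _; set K := _ `&` _ => cK.
have cK' : {within K, continuous (partial_t f)}.
  apply: continuous_in_subspaceT => z; rewrite inE => -[z0 _].
  by apply: cf; rewrite inE.
have [M [_ Mb]] := compact_bounded (continuous_compact cK' cK).
pose M' := Num.max 0 (M + 1).
exists M' => z z0; have [Kz|nKz] := pselect (K z); last first.
  have [_ Dz] := C1_compact_out z0 nKz.
  by rewrite /partial_t Dz normr0 le_max lexx.
apply: (Mb M'); last by exists z.
by rewrite /M' lt_max ltrDl ltr01 orbT.
Qed.

(** * The occupation measures solve the equation *)

Lemma continuous_along_ray (R : realType) (V : topologicalType)
    (G : R * (R * R) -> V) (e q : R * R) :
  {in @spacetime R, continuous G} ->
  forall z : R * R, 0 < z.1 -> {for z, continuous (fun z => G (z.1, ray e q z.2))}.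
Proof.
move=> cG z z0.
have cp : {for z, continuous (fun z : R * R => (z.1, ray e q z.2))}.
  apply: (@continuous_pair _ R (R * R)%type (fun z : R * R => z.1)
    (fun z => ray e q z.2) z).
    exact: cvg_fst.
  have cs : {for z, continuous (snd : R * R -> R)} by exact: cvg_snd.
  have cr : {for z.2, continuous (ray e q)} by exact: continuous_ray.
  exact: (@continuous_comp (R * R)%type R (R * R)%type snd (ray e q) z cs cr).
have cGz : {for (z.1, ray e q z.2), continuous G} by apply: cG; rewrite inE.
exact: (cvg_comp _ _ cp cGz).
Qed.

(** Exchanging the integrals over 0 < s <= t puts the integral in t inside,
    where the integrand is a t-derivative at a fixed point of the ray; its
    integral over [s, oo[ is minus the value at the lower end. *)
Lemma fubini_time_derivative (R : realType) (c : R) (e q : R * R)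
    (f : R * (R * R) -> R) : C1_compact f ->
  (\int[lebesgue_measure]_(t in `]0%R, +oo[)
     (c%:E * \int[lebesgue_measure]_(s in `[0%R, t]) (partial_t f (t, ray e q s))%:E) =
   \int[lebesgue_measure]_(s in `]0%R, +oo[) (- (c * f (s, ray e q s)))%:E)%E.
Proof.
move=> Cf; have [df cf _ _] := Cf.
have [a [b [a0 fab]]] := C1_compact_time Cf.
have [M fM] := C1_compact_partial_bounded Cf.
have cP := @continuous_along_ray R _ (partial_t f) e q cf.
pose G (z : R * R) := c * partial_t f (z.1, ray e q z.2).
have cG z : 0 < z.1 -> {for z, continuous G}.
  by move=> z0; apply: cvgM; [exact: cvg_cst|exact: cP].
have cG2 t : 0 < t -> continuous (fun s => G (t, s)).
  move=> t0 s; have cts : {for s, continuous (fun s : R => (t, s))}.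
    by apply: (@continuous_pair _ R R); [exact: cvg_cst|exact: cvg_id].
  exact: (cvg_comp _ _ cts (cG (t, s) t0)).
have cG1 s t : 0 < t -> {for t, continuous (fun t => G (t, s))}.
  move=> t0; have cts : {for t, continuous (fun t : R => (t, s))}.
    by apply: (@continuous_pair _ R R); [exact: cvg_id|exact: cvg_cst].
  exact: (cvg_comp _ _ cts (cG (t, s) t0)).
(* the triangle 0 < s <= t, with z = (t, s) *)
pose D : set (R * R) := [set z | 0 < z.2 /\ z.2 <= z.1].
(* the integrand vanishes for t > b, so only a bounded part of D matters *)
pose D' : set (R * R) := D `&` (`[0, b] `*` `[0, b]).
have mD : measurable D.
  have -> : D = snd @^-1` [set s : R | 0 < s] `&`
      ~` ((fun z : R * R => z.2 - z.1) @^-1` [set s : R | 0 < s]).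
    apply/seteqP; split => -[t s] /=; rewrite /D/= subr_gt0 => -[s0 st]; split => //.
      by apply/negP; rewrite -leNgt.
    by rewrite leNgt; apply/negP.
  apply: measurableI; [|apply: measurableC]; apply: open_measurable_prod;
    apply: open_comp; try exact: open_gt.
    by move=> z _; exact: cvg_snd.
  by move=> z _; apply: cvgB; [exact: cvg_snd|exact: cvg_fst].
have mD' : measurable D' by apply: measurableI => //; exact: measurableX.
have D0 z : D z -> 0 < z.1 by move=> [/lt_le_trans]; apply.
pose Phi := (EFin \o G) \_ D.
have PhiTS t s : Phi (t, s) = if 0 < s <= t then (G (t, s))%:E else 0%E.
  rewrite /Phi patchE; congr (if _ then _ else _).
  apply/idP/idP; first by rewrite inE => -[/= -> ->].
  by move=> /andP[s0 st]; rewrite inE.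
have PhiE : Phi = (EFin \o G) \_ D'.
  apply/funext => z; rewrite /Phi !patchE; case: ifPn; case: ifPn => //.
    rewrite notin_setE inE => nD' Dz; have z0 := D0 z Dz.
    have bz : b < z.1.
      rewrite ltNge; apply/negP => zb; apply: nD'; split => //.
      have [s0 st] := Dz.
      by split; rewrite /= in_itv/= ltW//= (le_trans st).
    have [|_ Dz0] := fab (z.1, ray e q z.2) z0; first by rewrite /= bz orbT.
    by rewrite /= /G /partial_t Dz0 mulr0.
  by rewrite inE notin_setE => -[Dz _] /(_ Dz).
have iPhi : ((@lebesgue_measure R) \x (@lebesgue_measure R))%E.-integrable setT Phi.
  rewrite PhiE; apply: (iffLR (integrable_mkcond _ _)) => //.
  apply: measurable_bounded_integrable => //.
  - apply: (@le_lt_trans _ _ (((@lebesgue_measure R) \x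
        (@lebesgue_measure R))%E (`[0, b] `*` `[0, b]))).
      by apply: le_measure; rewrite ?inE; [|exact: measurableX|exact: subIsetr].
    rewrite product_measure1E//= lebesgue_measure_itv/=.
    by case: ifP => _; rewrite ?mul0e ?ltry// -EFinD -EFinM ltry.
  - apply: (@measurable_continuous_in _ _ [set z | 0 < z.1]) => //.
    + apply: (@open_comp _ _ fst [set t : R | 0 < t]); last exact: open_gt.
      by move=> z _; exact: cvg_fst.
    + by move=> z [/D0].
    + by move=> z; rewrite inE; exact: cG.
  - exists (`|c| * M); split; first exact: num_real.
    move=> y My z [/D0 z0 _] /=; rewrite normrM; apply: le_trans (ltW My).
    by rewrite ler_wpM2l// fM.
transitivity (\int[lebesgue_measure]_t \int[lebesgue_measure]_s Phi (t, s))%E.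
  rewrite integral_mkcond; apply: eq_integral => t _; rewrite patchE.
  case: ifPn => [|t0].
    rewrite inE/= in_itv/= andbT => t0.
    rewrite -integralZl//; last first.
      apply: continuous_compact_integrable; first exact: segment_compact.
      apply: continuous_subspaceT => s.
      have cts : {for s, continuous (fun s : R => (t, s))}.
        by apply: (@continuous_pair _ R R); [exact: cvg_cst|exact: cvg_id].
      exact: (cvg_comp _ _ cts (cP (t, s) t0)).
    rewrite -integral_itv_obnd_cbnd; last first.
      apply: (@measurable_funS _ _ _ _ setT) => //; apply/measurable_EFinP.
      apply: continuous_measurable_fun; exact: (cG2 t t0).
    rewrite integral_mkcond; apply: eq_integral => s _.
    by rewrite PhiTS patchE mem_setE in_itv.
  rewrite mem_setE in_itv/= andbT -leNgt in t0.
  rewrite integral0_eq// => s _; rewrite PhiTS; case: ifP => // /andP[s0 st].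
  by have := lt_le_trans s0 (le_trans st t0); rewrite ltxx.
rewrite Fubini//.
rewrite [RHS]integral_mkcond; apply: eq_integral => s _; rewrite patchE.
case: ifPn => [|s0]; last first.
  rewrite mem_setE in_itv/= andbT in s0.
  by rewrite integral0_eq// => t _; rewrite PhiTS (negbTE s0).
rewrite inE/= in_itv/= andbT => s0.
transitivity (\int[lebesgue_measure]_(t in `[s, +oo[) (G (t, s))%:E)%E.
  rewrite [RHS]integral_mkcond; apply: eq_integral => t _.
  by rewrite PhiTS patchE mem_setE in_itv/= andbT s0.
apply: (@integral_deriv_tail R (fun t => c * f (t, ray e q s)) _ s b s0).
- move=> t t0; rewrite /G /=; apply: is_deriveZ.
  by apply: is_derive_time; apply: df; rewrite inE.
- by move=> t t0; exact: cG1.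
- move=> t t0 bt; have [|fz Dz] := fab (t, ray e q s) t0; first by rewrite bt orbT.
  by rewrite /G /partial_t fz Dz mulr0.
Qed.

Lemma ray0 (R : realType) (e q : R * R) : ray e q 0 = e.
Proof. by rewrite /ray !mul0r !addr0 -surjective_pairing. Qed.

Lemma continuous_drift (R : realType) (q : R * R) (f : R * (R * R) -> R) :
  {in @spacetime R, continuous (grad_x f)} ->
  {in @spacetime R, continuous (fun z => dot q (grad_x f z))}.
Proof.
move=> cg z z0; have cgz := cg z z0.
have c1 : {for z, continuous (fun z => (grad_x f z).1)}.
  exact: (@continuous_comp _ _ _ (grad_x f) fst z cgz (@cvg_fst _ _ _ _ _)).
have c2 : {for z, continuous (fun z => (grad_x f z).2)}.
  exact: (@continuous_comp _ _ _ (grad_x f) snd z cgz (@cvg_snd _ _ _ _ _)).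
by apply: cvgD; apply: cvgM; [exact: cvg_cst|exact: c1|exact: cvg_cst|exact: c2].
Qed.

Lemma continuous_slice (R : realType) (G : R * (R * R) -> R) (t : R) :
  {in @spacetime R, continuous G} -> 0 < t -> continuous (fun x => G (t, x)).
Proof.
move=> cG t0 x.
have cp : {for x, continuous (fun x : R * R => (t, x))}.
  by apply: (@continuous_pair (R * R)%type R (R * R)%type); [exact: cvg_cst|exact: cvg_id].
have cGz : {for (t, x), continuous G} by apply: cG; rewrite inE.
exact: (cvg_comp _ _ cp cGz).
Qed.

(** Along the ray the drift term is the derivative in s. *)
Lemma integral_drift_along_ray (R : realType) (e q : R * R) (t : R)
    (f : R * (R * R) -> R) : C1_compact f -> 0 < t ->
  (\int[lebesgue_measure]_(s in `[0%R, t]) (dot q (grad_x f (t, ray e q s)))%:E =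
   (f (t, ray e q t) - f (t, e))%:E)%E.
Proof.
move=> [df _ cg _] t0.
have dr s : is_derive s (1 : R) (fun u => f (t, ray e q u))
    (dot q (grad_x f (t, ray e q s))).
  by apply: is_derive_ray; apply: df; rewrite inE.
have cr s : {for s, continuous (fun u => f (t, ray e q u))}.
  apply/differentiable_continuous/derivable1_diffP.
  by have [] := dr s.
rewrite (@continuous_FTC2 _ (fun s => dot q (grad_x f (t, ray e q s)))
  (fun u => f (t, ray e q u)))//.
- by rewrite ray0 -EFinB.
- apply: continuous_subspaceT => s.
  exact: (@continuous_comp _ _ _ _ _ s (@continuous_ray R e q s)
    (@continuous_slice R _ t (@continuous_drift R q f cg) t0 _)).
- split.
  + by move=> s _; have [] := dr s.
  + by apply: cvg_at_right_filter; exact: cr.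
  + by apply: cvg_at_left_filter; exact: cr.
- by move=> s _; rewrite derive1E; have [] := dr s.
Qed.

Lemma occupation_weak_solution (R : realType) (alpha : R) (e q : R * R)
    (mu : R -> finite_borel R) : 0 <= alpha ->
    (forall t, occupation alpha e q t (mu t)) ->
  weak_solution q alpha e mu.
Proof.
move=> a0 mE; split; first exact: (occupation_continuous a0 mE).
  move=> A mA; rewrite (mE 0 A mA) (_ : lebesgue_measure _ = 0%E) ?mule0//.
  have mray : measurable (ray e q @^-1` A : set (measurableTypeR R)).
    by rewrite -[X in measurable X]setTI; exact: measurable_ray.
  apply/eqP; rewrite eq_le measure_ge0 andbT.
  apply: (@le_trans _ _ (lebesgue_measure `[0%R, 0%R])).
    by apply: le_measure; rewrite ?inE//; exact: measurableI.
  by rewrite lebesgue_measure_itv/= ltxx.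
move=> f Cf; have [df ct cg _] := Cf.
have [a [b [a_gt0 fab]]] := C1_compact_time Cf.
have cf : {in @spacetime R, continuous f}.
  by move=> z z0; exact: differentiable_continuous (df z z0).
have cray (t : R) : 0 < t -> {for t, continuous (fun t => f (t, ray e q t))}.
  move=> t0.
  have cp : {for t, continuous (fun t : R => (t, ray e q t))}.
    apply: (@continuous_pair R R (R * R)%type); [exact: cvg_id|exact: continuous_ray].
  have cfz : {for (t, ray e q t), continuous f} by apply: cf; rewrite inE.
  exact: (cvg_comp _ _ cp cfz).
have ce (t : R) : 0 < t -> {for t, continuous (fun t => f (t, e))}.
  move=> t0.
  have cp : {for t, continuous (fun t : R => (t, e))}.
    apply: (@continuous_pair R R (R * R)%type); [exact: cvg_id|exact: cvg_cst].
  have cfz : {for (t, e), continuous f} by apply: cf; rewrite inE.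
  exact: (cvg_comp _ _ cp cfz).
have -> : (\int[lebesgue_measure]_(t in `]0%R, +oo[)
            \int[mu t]_x (partial_t f (t, x))%:E =
    \int[lebesgue_measure]_(t in `]0%R, +oo[) (- (alpha * f (t, ray e q t)))%:E)%E.
  rewrite -fubini_time_derivative//; apply: eq_integral => t.
  rewrite mem_setE in_itv/= andbT => t0.
  by rewrite (integral_occupation a0 (mE t))//; exact: continuous_slice.
have -> : (\int[lebesgue_measure]_(t in `]0%R, +oo[)
            \int[mu t]_x (dot q (grad_x f (t, x)))%:E =
    \int[lebesgue_measure]_(t in `]0%R, +oo[) (alpha * (f (t, ray e q t) - f (t, e)))%:E)%E.
  apply: eq_integral => t; rewrite mem_setE in_itv/= andbT => t0.
  rewrite (integral_occupation a0 (mE t)); last first.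
    exact: (@continuous_slice R _ t (@continuous_drift R q f cg) t0).
  by rewrite integral_drift_along_ray.
have [|ie _] := @integral_halfline R (fun t => f (t, e)) a b a_gt0 ce.
  by move=> t t0 tab; have [-> _] := fab (t, e) t0 tab.
have [|iray _] := @integral_halfline R (fun t => f (t, ray e q t)) a b a_gt0 cray.
  by move=> t t0 tab; have [-> _] := fab (t, ray e q t) t0 tab.
rewrite -integralZl//.
have i1 : lebesgue_measure.-integrable `]0%R, +oo[
    (fun t => (- (alpha * f (t, ray e q t)))%:E).
  rewrite (_ : (fun t => _) = (fun t => (- alpha)%:E * (f (t, ray e q t))%:E)%E).
    exact: integrableZl.
  by apply/funext => t; rewrite -EFinM mulNr.
have i2 : lebesgue_measure.-integrable `]0%R, +oo[
    (fun t => (alpha * (f (t, ray e q t) - f (t, e)))%:E).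
  rewrite (_ : (fun t => _) =
    (fun t => alpha%:E * ((f (t, ray e q t))%:E - (f (t, e))%:E))%E).
    by apply: integrableZl => //; exact: integrableB.
  by apply/funext => t; rewrite -EFinB -EFinM.
rewrite -integralD// -integralD//; last 2 first.
- exact: integrableD.
- exact: integrableZl.
rewrite integral0_eq// => t _; rewrite -EFinM -!EFinD; congr EFin; ring.
Qed.

(** * Continuously differentiable bumps on the line *)

(** A quadratic error bound is exact enough to read off derivatives of functions
    defined by cases, such as the square of a positive part. *)
Lemma is_derive_quadratic (R : realType) (F : R -> R) (y D : R) :
  (forall h, `|F (h + y) - F y - D * h| <= h ^+ 2) -> is_derive y (1 : R) F D.
Proof.
move=> Fh.
have cv : h^-1 *: ((F \o shift y) (h *: (1 : R)) - F y) @[h --> 0^'] --> D.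
  apply/cvgrPdist_le => eps eps0; near=> h.
  have h0 : h != 0 by near: h; exact: nbhs_dnbhs_neq.
  rewrite /= scaler1 -(@ler_pM2l _ `|h|) ?normr_gt0// -normrM.
  have -> : h * (D - h^-1 *: (F (h + y) - F y)) = - (F (h + y) - F y - D * h).
    rewrite mulrBr /GRing.scale/= mulrA divff// mul1r; ring.
  rewrite normrN; apply: (le_trans (Fh h)); rewrite -real_normK ?num_real// expr2.
  rewrite ler_pM2l ?normr_gt0//.
  by near: h; apply: dnbhs0_le.
by apply: DeriveDef; [apply/cvg_ex; exists D|exact: cvg_lim cv].
Unshelve. all: by end_near. Qed.

Lemma is_derive_sqr_pos (R : realType) (y : R) :
  is_derive y (1 : R) (fun y => Num.max 0 y ^+ 2) (2 * Num.max 0 y).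
Proof.
apply: is_derive_quadratic => h; rewrite ler_norml.
by have [] := leP 0 y; have [] := leP 0 (h + y) => ? ?; apply/andP; split; nra.
Qed.

(** For a <= b, a parabolic arch over ]a, b[, cut off at 0.  Its square is continuously
    differentiable, and it is also used as a positive weight. *)
Definition hat (R : realType) (a b x : R) : R := Num.max 0 ((x - a) * (b - x)).

Lemma hat_ge0 (R : realType) (a b x : R) : 0 <= hat a b x.
Proof. by rewrite /hat le_max lexx. Qed.

Lemma hat_gt0 (R : realType) (a b x : R) : a < x < b -> 0 < hat a b x.
Proof. by move=> /andP[? ?]; rewrite /hat lt_max mulr_gt0 ?subr_gt0 ?orbT. Qed.

Lemma hat_out (R : realType) (a b x : R) :
  a <= b -> x \notin `]a, b[ -> hat a b x = 0.
Proof.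
move=> ab; rewrite in_itv/= negb_and -!leNgt => xab.
by apply/max_idPl; case/orP : xab => ?; nra.
Qed.

Lemma continuous_hat (R : realType) (a b : R) : continuous (hat a b).
Proof.
have cp : continuous (fun x : R => (x - a) * (b - x)).
  by move=> x; apply: cvgM; apply: cvgB; try exact: cvg_cst; exact: cvg_id.
move=> x; have c0 : {for x, continuous (fun=> 0 : R^o)} by exact: cvg_cst.
exact: (@continuous_max R R (fun=> 0) (fun x => (x - a) * (b - x)) x c0 (cp x)).
Qed.

(** For a <= b, continuously differentiable, supported in [a, b], and increasing
    with n to the indicator of ]a, b[. *)
Definition C1_bump (R : realType) (a b : R) (n : nat) (x : R) : R :=
  1 - expR (- (n%:R * hat a b x ^+ 2)).

(** g' is carried along as data, so that continuity and support of the
    derivative can be stated directly. *)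
Definition C1_compact_line (R : realType) (g g' : R -> R) : Prop :=
  [/\ forall x : R, is_derive x (1 : R) g (g' x), continuous g' &
    exists M : R, forall x : R, M < `|x| -> g x = 0 /\ g' x = 0].

Lemma C1_line_continuous (R : realType) (g g' : R -> R) :
  C1_compact_line g g' -> continuous g.
Proof.
move=> [dg _ _] x; apply/differentiable_continuous/derivable1_diffP.
by have [] := dg x.
Qed.

Lemma bump_C1 (R : realType) (a b : R) (n : nat) : a <= b ->
  exists g', C1_compact_line (C1_bump a b n) g'.
Proof.
move=> ab; pose m := hat a b.
exists (fun x => n%:R * expR (- (n%:R * m x ^+ 2)) * (2 * m x * (a + b - 2 * x))); split.
- move=> x.
  have dp : is_derive x (1 : R) (fun x => (x - a) * (b - x)) (a + b - 2 * x).
    apply: is_derive_quadratic => h.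
    rewrite (_ : _ - _ = - h ^+ 2); last by ring.
    by rewrite normrN ger0_norm// sqr_ge0.
  have dm := @is_derive1_comp R (fun y => Num.max 0 y ^+ 2)
    (fun x => (x - a) * (b - x)) x _ _ (@is_derive_sqr_pos R _) dp.
  have de : is_derive (m x ^+ 2) (1 : R) (fun y => 1 - expR (- (n%:R * y)))
      (n%:R * expR (- (n%:R * m x ^+ 2))).
    have dl (y : R) : is_derive y (1 : R) (fun y => - (n%:R * y)) (- n%:R).
      apply: is_derive_quadratic => h.
      by rewrite (_ : _ - _ = 0) ?normr0 ?sqr_ge0//; ring.
    have dd := @is_derive1_comp R expR (fun y => - (n%:R * y)) (m x ^+ 2) _ _
      (is_derive_expR _) (dl _).
    have d1 (y : R) : is_derive y (1 : R) (fun y => 1 - y) (- 1).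
      apply: is_derive_quadratic => h.
      by rewrite (_ : _ - _ = 0) ?normr0 ?sqr_ge0//; ring.
    have := @is_derive1_comp R (fun y => 1 - y) _ _ _ _ (d1 _) dd.
    by rewrite mulN1r mulrN opprK mulrC.
  exact: (@is_derive1_comp R _ _ x _ _ de dm).
- have cm : continuous m by exact: continuous_hat.
  move=> x; apply: cvgM; [|apply: cvgM].
  + apply: cvgM; first exact: cvg_cst.
    apply: (@continuous_comp _ _ _ (fun x => - (n%:R * m x ^+ 2)) expR);
      last exact: continuous_expR.
    apply: cvgN; apply: cvgM; first exact: cvg_cst.
    by apply: cvgM; exact: cm.
  + by apply: cvgM; [exact: cvg_cst|exact: cm].
  + apply: cvgB; first exact: cvg_cst.
    by apply: cvgM; [exact: cvg_cst|exact: cvg_id].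
- exists (`|a| + `|b|) => x xM.
  have x0 : m x = 0.
    apply: hat_out => //; apply: contraTN xM; rewrite in_itv/= => /andP[ax xb].
    rewrite -leNgt ler_norml.
    have := ler_norm b; have := ler_norm (- a); rewrite normrN.
    have := normr_ge0 a; have := normr_ge0 b.
    by move=> *; apply/andP; split; lra.
  by rewrite /C1_bump -/(m x) x0 expr0n/= !mulr0 oppr0 expR0 subrr mul0r mulr0.
Qed.

Lemma bump_ge0_le1 (R : realType) (a b : R) (n : nat) (x : R) :
  0 <= C1_bump a b n x <= 1.
Proof.
by rewrite /C1_bump subr_ge0 expR_le1 oppr_le0 mulr_ge0 ?sqr_ge0//= gerBl expR_ge0.
Qed.

Lemma cvg_bump (R : realType) (a b x : R) : a <= b ->
  C1_bump a b n x @[n --> \oo] --> (\1_(`]a, b[%classic) x : R).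
Proof.
move=> ab; rewrite /C1_bump indicE mem_setE; set p := hat a b x.
have -> : (fun n => 1 - expR (- (n%:R * p ^+ 2))) = (fun n => 1 - expR (- p ^+ 2) ^+ n).
  by apply/funext => n; rewrite -expRM_natl mulrN.
have [xab|xab] := boolP (x \in `]a, b[).
  rewrite -[X in _ --> X]subr0; apply: cvgB; first exact: cvg_cst.
  apply: cvg_expr; rewrite ger0_norm ?expR_ge0// -expR0 ltr_expR oppr_lt0 exprn_gt0//.
  by apply: hat_gt0; rewrite in_itv in xab.
rewrite /p hat_out// expr0n/= oppr0 expR0.
under eq_fun do rewrite expr1n subrr.
exact: cvg_cst.
Qed.

(** * Integrals in a moving frame *)

Definition compactly_supported (R : realType) (h : R * R -> R) : Prop :=
  continuous h /\ exists M : R, forall x : R * R,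
    (M < `|x.1|) || (M < `|x.2|) -> h x = 0.

Lemma compactly_supported_bounded (R : realType) (h : R * R -> R) :
  compactly_supported h -> exists C : R, forall x, `|h x| <= C.
Proof.
move=> [ch [M hM]].
have cB : compact (`[- M, M] `*` `[- M, M] : set (R * R)).
  by apply: compact_setX; exact: segment_compact.
have [C [_ hC]] := compact_bounded (continuous_compact (continuous_subspaceT ch) cB).
exists (Num.max 0 (C + 1)) => x.
have [xM|xM] := boolP ((M < `|x.1|) || (M < `|x.2|)).
  by rewrite hM// normr0 le_max lexx.
apply: hC; first by rewrite lt_max ltrDl ltr01 orbT.
exists x => //; move: xM; rewrite negb_or -!leNgt => /andP[x1 x2].
by split; rewrite /= in_itv/= -ler_norml.
Qed.

Lemma integrable_bounded_plane (R : realType) (m : finite_borel R)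
    (h : R * R -> R) (C : R) : continuous h -> (forall x, `|h x| <= C) ->
  m.-integrable setT (EFin \o h).
Proof.
move=> ch hC; apply: (@measurable_bounded_integrable _ (borel_plane R) R) => //.
- by rewrite ltey_eq; have -> := @fin_num_measure _ _ _ m setT measurableT.
- exact: continuous_borel_plane.
- exists C; split; first exact: num_real.
  by move=> y Cy x _ /=; exact: le_trans (hC x) (ltW Cy).
Qed.

Lemma continuous_ray_joint (R : realType) (q : R * R) :
  continuous (fun z : R * (R * R) => ray z.2 q z.1).
Proof.
move=> z; have cs : {for z, continuous (snd : R * (R * R) -> R * R)} by exact: cvg_snd.
have c1 : {for z, continuous (fun z : R * (R * R) => z.2.1)}.
  exact: (@continuous_comp (R * (R * R))%type (R * R)%type R
    snd fst z cs (@cvg_fst _ _ _ _ _)).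
have c2 : {for z, continuous (fun z : R * (R * R) => z.2.2)}.
  exact: (@continuous_comp (R * (R * R))%type (R * R)%type R
    snd snd z cs (@cvg_snd _ _ _ _ _)).
have c0 : {for z, continuous (fst : R * (R * R) -> R)} by exact: cvg_fst.
apply: (@continuous_pair _ R R (fun z : R * (R * R) => z.2.1 + z.1 * q.1)
    (fun z => z.2.2 + z.1 * q.2) z).
  by apply: cvgD; [exact: c1|apply: cvgM; [exact: c0|exact: cvg_cst]].
by apply: cvgD; [exact: c2|apply: cvgM; [exact: c0|exact: cvg_cst]].
Qed.

Lemma continuous_ray_from (R : realType) (q : R * R) (t : R) :
  continuous (fun x : R * R => ray x q t).
Proof.
move=> x; have cp : {for x, continuous (fun x : R * R => (t, x))}.
  by apply: (@continuous_pair (R * R)%type R (R * R)%type); [exact: cvg_cst|exact: cvg_id].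
exact: (cvg_comp _ _ cp (@continuous_ray_joint R q (t, x))).
Qed.

(** For t close to s both translates of h vanish outside one fixed square, and
    on that compact square pointwise continuity in (t, x) is uniform in x. *)
Lemma shift_uniform (R : realType) (q : R * R) (h : R * R -> R) (s eps : R) :
  compactly_supported h -> 0 < eps ->
  \forall t \near s, forall x, `|h (ray x q t) - h (ray x q s)| < eps.
Proof.
move=> [ch [M hM]] eps0.
(* for |t| < |s| + 1 the point x moves by less than (|s| + 1) |q_i| *)
pose N := M + (`|s| + 1) * (`|q.1| + `|q.2|).
have cB : compact (`[- N, N] `*` `[- N, N] : set (R * R)).
  by apply: compact_setX; exact: segment_compact.
have cH (z : R * (R * R)) :
    {for z, continuous (fun z : R * (R * R) => h (ray z.2 q z.1))}.
  exact: (cvg_comp _ _ (@continuous_ray_joint R q z) (ch _)).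
have cH' (z : R * (R * R)) :
    {for z, continuous (fun z : R * (R * R) => h (ray z.2 q z.1) - h (ray z.2 q s))}.
  apply: cvgB; first exact: cH.
  have cs : {for z, continuous (snd : R * (R * R) -> R * R)} by exact: cvg_snd.
  have cr := cvg_comp _ _ cs (@continuous_ray_from R q s z.2).
  exact: (cvg_comp _ _ cr (ch _)).
have near_box : \forall t \near s, (`[- N, N] `*` `[- N, N] : set (R * R)) `<=`
    (fun x => `|h (ray x q t) - h (ray x q s)| < eps).
  have := iffLR (compact_near_coveringP _) cB R (nbhs s)
    (fun t x => `|h (ray x q t) - h (ray x q s)| < eps) _.
  apply => x _.
  have /cvgrPdist_lt/(_ _ eps0) := cH' (s, x).
  rewrite /= subrr; under eq_near do rewrite sub0r normrN.
  move=> [[U V] /= [sU xV] UV]; exists (V, U) => //= -[y u] [/= Vy Uu].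
  exact: (UV (u, y)).
have near1 : \forall t \near s, `|t| < `|s| + 1.
  have : {for s, continuous (fun t : R => `|t|)} by exact: norm_continuous.
  by move=> /(_ [set y | y < `|s| + 1]); apply; apply: lt_nbhsl; rewrite ltrDl.
near=> t => x.
have [xB|xB] := pselect ((`[- N, N] `*` `[- N, N] : set (R * R)) x).
  by have := xB; move: x {xB}; near: t.
have tN : `|t| < `|s| + 1 by near: t.
have out (u : R) : `|u| < `|s| + 1 -> h (ray x q u) = 0.
  move=> us; apply: hM; apply: contrapT => /negP; rewrite negb_or -!leNgt => /andP[x1 x2].
  apply: xB.
  have [q1 q2] := (normr_ge0 q.1, normr_ge0 q.2).
  have u1 : `|u * q.1| <= (`|s| + 1) * `|q.1| by rewrite normrM ler_wpM2r// ltW.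
  have u2 : `|u * q.2| <= (`|s| + 1) * `|q.2| by rewrite normrM ler_wpM2r// ltW.
  have s0 := normr_ge0 s.
  have y1 : `|x.1| <= `|x.1 + u * q.1| + `|u * q.1|.
    by rewrite -[X in `|X| <= _](addrK (u * q.1)) ler_normB.
  have y2 : `|x.2| <= `|x.2 + u * q.2| + `|u * q.2|.
    by rewrite -[X in `|X| <= _](addrK (u * q.2)) ler_normB.
  move: x1 x2; rewrite /ray/= => x1 x2.
  by split; rewrite /= in_itv/= -ler_norml /N; nra.
by rewrite !out ?ltrDl// subrr normr0.
Unshelve. all: by end_near. Qed.

Lemma continuous_comp_shift (R : realType) (q : R * R) (h : R * R -> R) (t : R) :
  continuous h -> continuous (fun x => h (ray x q t)).
Proof.
move=> ch x.
have cr : {for x, continuous (fun x : R * R => ray x q t)} by exact: continuous_ray_from.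
exact: (cvg_comp _ _ cr (ch _)).
Qed.

Lemma compactly_supported_shift_integrable (R : realType) (m : finite_borel R)
    (q : R * R) (h : R * R -> R) (t : R) : compactly_supported h ->
  m.-integrable setT (fun x => (h (ray x q t))%:E).
Proof.
move=> ch; have [C hC] := compactly_supported_bounded ch.
apply: (@integrable_bounded_plane R m (fun x => h (ray x q t)) C) => //.
exact: continuous_comp_shift ch.1.
Qed.

(** The integrand and the measure both move.  The integrands converge uniformly
    while the masses stay bounded near s, and for the integrand frozen at time s
    weak continuity applies. *)
Lemma continuous_shifted_integral (R : realType) (nu : R -> finite_borel R)
    (q : R * R) (h : R * R -> R) :
    {within [set t | 0 <= t], continuous nu} -> compactly_supported h ->
  {within [set t | 0 <= t], continuous (fun t => \int[nu t]_x h (ray x q t))}.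
Proof.
move=> /weak_continuousP cnu ch; have [C0 hC0] := compactly_supported_bounded ch.
apply/subspace_continuousP => s s0.
have int_shift t u : (nu t).-integrable setT (fun x => (h (ray x q u))%:E).
  exact: compactly_supported_shift_integrable.
have one_bc : continuous (fun _ : R * R => 1 : R) /\
    bounded_fun (fun _ : R * R => 1 : R^o).
  split; first by move=> x; exact: cvg_cst.
  by exists (1 : R); split; [exact: num_real|move=> y y1 x _ /=; rewrite normr1 ltW].
have hs_bc : continuous (fun x : R * R => h (ray x q s)) /\
    bounded_fun (fun x : R * R => h (ray x q s) : R^o).
  split; first by exact: continuous_comp_shift ch.1.
  exists C0; split; first exact: num_real.
  by move=> y y1 x _ /=; exact: le_trans (hC0 _) (ltW y1).
pose one : bounded_continuous R := exist _ _ one_bc.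
pose hs : bounded_continuous R := exist _ _ hs_bc.
have /subspace_continuousP/(_ s s0) c1 := cnu one.
have /subspace_continuousP/(_ s s0) chs := cnu hs.
(* C bounds the mass of nu t for t near s *)
pose C := \int[nu s]_x 1 + 1.
have C1 : 0 < C by rewrite ltr_wpDl// Rintegral_ge0.
apply/cvgrPdist_lt => eps eps0.
have e2 : 0 < eps / 2 by rewrite divr_gt0.
have e3 : 0 < eps / 2 / C by rewrite divr_gt0.
move/cvgrPdist_lt/(_ _ ltr01) : c1 => /= c1.
move/cvgrPdist_lt/(_ _ e2) : chs => /= chs.
have cu : \forall t \near within [set t | 0 <= t] (nbhs s),
    forall x, `|h (ray x q t) - h (ray x q s)| < eps / 2 / C.
  by apply: cvg_within; exact: shift_uniform.
near=> t.
rewrite (_ : _ - _ = (\int[nu s]_x h (ray x q s) - \int[nu t]_x h (ray x q s)) +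
  (\int[nu t]_x h (ray x q s) - \int[nu t]_x h (ray x q t))); last by rewrite addrA subrK.
apply: le_lt_trans (ler_normD _ _) _.
rewrite [X in _ < X](splitr eps); apply: ltr_leD; first by near: t.
have mass : \int[nu t]_x 1 <= C.
  rewrite /C -lerBlDl; apply: ltW; apply: le_lt_trans (ler_norm _) _.
  by rewrite distrC; near: t.
have ct : forall x, `|h (ray x q t) - h (ray x q s)| < eps / 2 / C by near: t.
have ib : (nu t).-integrable setT (fun x => (h (ray x q s) - h (ray x q t))%:E).
  exact: (integrableB measurableT (int_shift t s) (int_shift t t)).
have icst (c : R) : (nu t).-integrable setT (fun=> c%:E).
  by apply: (@integrable_bounded_plane R (nu t) (fun=> c) `|c|) => // x; exact: cvg_cst.
rewrite -RintegralB//; first last.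
- exact: int_shift.
- exact: int_shift.
apply: le_trans (le_normr_Rintegral measurableT ib) _.
apply: (@le_trans _ _ (\int[nu t]_x (eps / 2 / C * 1))).
  apply: le_Rintegral => //.
  - exact: (integrable_norm ib).
  - exact: icst.
  - by move=> x _; rewrite mulr1 distrC ltW.
rewrite RintegralZl//; last exact: icst.
by rewrite mulrAC ler_pdivrMr// ler_wpM2l// ltW.
Unshelve. all: by end_near. Qed.

(** * Travelling test functions *)

Lemma eq_continuous_in (T U : topologicalType) (A : set T) (G F : T -> U) :
  open A -> {in A, F =1 G} -> {in A, continuous G} -> {in A, continuous F}.
Proof.
move=> oA FG; rewrite -!continuous_open_subspace//.
apply: subspace_eq_continuous => x xA; rewrite /from_subspace; exact/esym/FG.
Qed.

Lemma is_derive_mul (R : realType) (f g : R -> R) (x df dg : R) :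
  is_derive x (1 : R) f df -> is_derive x (1 : R) g dg ->
  is_derive x (1 : R) (fun u => f u * g u) (df * g x + f x * dg).
Proof.
move=> fd gd; have := is_deriveM fd gd.
by move/is_derive_eq; apply; rewrite /GRing.scale/=; ring.
Qed.

Lemma is_derive_affine (R : realType) (c v s : R) :
  is_derive s (1 : R) (fun u => c + u * v) v.
Proof.
apply: is_derive_quadratic => h.
by rewrite (_ : _ - _ = 0) ?normr0 ?sqr_ge0//; ring.
Qed.

Lemma is_derive_comp_affine (R : realType) (g : R -> R) (dg c v s : R) :
  is_derive (c + s * v) (1 : R) g dg ->
  is_derive s (1 : R) (fun u => g (c + u * v)) (dg * v).
Proof.
move=> gd.
exact: (@is_derive1_comp R g (fun u => c + u * v) s _ _ gd (is_derive_affine c v s)).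
Qed.

(** Recovers the gradient from its scalar products, for which the derivative along
    a line is available. *)
Lemma dot_pair (R : realType) (x : R * R) : x = (dot (1, 0) x, dot (0, 1) x).
Proof. by case: x => x1 x2; rewrite /dot/= !mul1r !mul0r addr0 add0r. Qed.

Definition tensor (R : realType) (g1 g2 : R -> R) (x : R * R) : R :=
  g1 x.1 * g2 x.2.

Lemma continuous_tensor (R : realType) (g1 g2 : R -> R) :
  continuous g1 -> continuous g2 -> continuous (tensor g1 g2).
Proof.
move=> c1 c2 x.
have p1 : {for x, continuous (fst : R * R -> R)} by exact: cvg_fst.
have p2 : {for x, continuous (snd : R * R -> R)} by exact: cvg_snd.
by apply: cvgM; [exact: (cvg_comp _ _ p1 (c1 _))|exact: (cvg_comp _ _ p2 (c2 _))].
Qed.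

Lemma compactly_supported_tensor (R : realType) (g1 g1' g2 g2' : R -> R) :
  C1_compact_line g1 g1' -> C1_compact_line g2 g2' ->
  [/\ compactly_supported (tensor g1 g2), compactly_supported (tensor g1' g2) &
      compactly_supported (tensor g1 g2')].
Proof.
move=> hg1 hg2; have cg1 := C1_line_continuous hg1.
have cg2 := C1_line_continuous hg2.
have [_ cg1' [M1 h1]] := hg1; have [_ cg2' [M2 h2]] := hg2.
split; (split; first exact: continuous_tensor);
  exists (Num.max M1 M2) => x; rewrite !gt_max;
  move=> /orP[/andP[/h1[e1 e1'] _]|/andP[_ /h2[e2 e2']]];
  by rewrite /tensor ?e1 ?e1' ?e2 ?e2' ?mul0r ?mulr0.
Qed.

(** phi (t) h (x - tq), written with the backward ray x - tq. *)
Definition travelling (R : realType) (phi : R -> R) (h : R * R -> R) (q : R * R)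
    (z : R * (R * R)) : R := phi z.1 * h (ray z.2 (- q) z.1).

Section travelling_test.
Variables (R : realType) (g1 g1' g2 g2' : R -> R) (q : R * R).
Hypothesis hg1 : C1_compact_line g1 g1'.
Hypothesis hg2 : C1_compact_line g2 g2'.
Variables (phi psi : R -> R) (a b : R).
Hypothesis a0 : 0 < a.
Hypothesis dphi : forall t : R, 0 < t -> is_derive t (1 : R) phi (psi t).
Hypothesis cpsi : forall t : R, 0 < t -> {for t, continuous psi}.
Hypothesis phi0 : forall t : R, 0 < t -> (t < a) || (b < t) -> phi t = 0 /\ psi t = 0.

Let f := travelling phi (tensor g1 g2) q.

Lemma travelling_differentiable (z : R * (R * R)) : 0 < z.1 -> differentiable f z.
Proof.
move=> z0; have [dg1 _ _] := hg1; have [dg2 _ _] := hg2.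
have d0 : differentiable (fst : R * (R * R) -> R) z.
  by apply: linear_differentiable => w; exact: cvg_fst.
have ds : differentiable (snd : R * (R * R) -> R * R) z.
  by apply: linear_differentiable => w; exact: cvg_snd.
have d1 : differentiable (fun z : R * (R * R) => z.2.1) z.
  apply: (@differentiable_comp _ _ _ _ snd fst) => //.
  by apply: linear_differentiable => w; exact: cvg_fst.
have d2 : differentiable (fun z : R * (R * R) => z.2.2) z.
  apply: (@differentiable_comp _ _ _ _ snd snd) => //.
  by apply: linear_differentiable => w; exact: cvg_snd.
apply: differentiableM; last apply: differentiableM.
- apply: (@differentiable_comp _ _ _ _ fst phi) => //.
  by apply/derivable1_diffP; have [] := dphi z0.
- apply: (@differentiable_comp _ _ _ _ (fun z : R * (R * R) => z.2.1 + z.1 * - q.1) g1).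
    by apply: differentiableD => //; apply: differentiableM.
  by apply/derivable1_diffP; have [] := dg1 (z.2.1 + z.1 * - q.1).
- apply: (@differentiable_comp _ _ _ _ (fun z : R * (R * R) => z.2.2 + z.1 * - q.2) g2).
    by apply: differentiableD => //; apply: differentiableM.
  by apply/derivable1_diffP; have [] := dg2 (z.2.2 + z.1 * - q.2).
Qed.

(** The term with factor phi is the opposite of the drift term of
    travelling_grad_x with v = q; this is the cancellation that removes the
    transport from the equation. *)
Lemma travelling_partial_t (t : R) (x : R * R) : 0 < t ->
  partial_t f (t, x) = psi t * tensor g1 g2 (ray x (- q) t)
    - phi t * (q.1 * tensor g1' g2 (ray x (- q) t) + q.2 * tensor g1 g2' (ray x (- q) t)).
Proof.
move=> t0; have [dg1 _ _] := hg1; have [dg2 _ _] := hg2.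
have [_ <-] := is_derive_time (@travelling_differentiable (t, x) t0).
have := is_derive_mul (dphi t0)
  (is_derive_mul (is_derive_comp_affine (dg1 (x.1 + t * - q.1)))
    (is_derive_comp_affine (dg2 (x.2 + t * - q.2)))).
by move=> [_ ->]; rewrite /tensor /ray /=; ring.
Qed.

Lemma travelling_grad_x (t : R) (x v : R * R) : 0 < t ->
  dot v (grad_x f (t, x)) =
  phi t * (v.1 * tensor g1' g2 (ray x (- q) t) + v.2 * tensor g1 g2' (ray x (- q) t)).
Proof.
move=> t0; have [dg1 _ _] := hg1; have [dg2 _ _] := hg2.
have := @is_derive_ray R f t 0 x v; rewrite ray0.
move=> /(_ (@travelling_differentiable (t, x) t0)) [_ <-].
have d1 : is_derive 0 (1 : R) (fun u => g1 ((x.1 + t * - q.1) + u * v.1))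
    (g1' (x.1 + t * - q.1) * v.1).
  by apply: is_derive_comp_affine; rewrite mul0r addr0.
have d2 : is_derive 0 (1 : R) (fun u => g2 ((x.2 + t * - q.2) + u * v.2))
    (g2' (x.2 + t * - q.2) * v.2).
  by apply: is_derive_comp_affine; rewrite mul0r addr0.
have dc : is_derive 0 (1 : R) (fun=> phi t) 0 by exact: is_derive_cst.
have := is_derive_mul dc (is_derive_mul d1 d2).
rewrite (_ : (fun u => phi t * _) = fun u => f (t, ray x v u)); last first.
  apply/funext => u; rewrite /f /travelling /tensor /ray/=.
  by congr (_ * (g1 _ * g2 _)); ring.
by move=> [_ ->]; rewrite /tensor /ray /=  !mul0r !addr0; ring.
Qed.

Let continuous_along (k : R * R -> R) (z : R * (R * R)) :
  continuous k -> {for z, continuous (fun z : R * (R * R) => k (ray z.2 (- q) z.1))}.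
Proof.
move=> ck.
have cr : {for z, continuous (fun z : R * (R * R) => ray z.2 (- q) z.1)}.
  exact: continuous_ray_joint.
exact: (cvg_comp _ _ cr (ck _)).
Qed.

Let continuous_time (k : R -> R) (z : R * (R * R)) :
  {for z.1, continuous k} -> {for z, continuous (fun z : R * (R * R) => k z.1)}.
Proof.
move=> ck; have c1 : {for z, continuous (fst : R * (R * R) -> R)} by exact: cvg_fst.
exact: (cvg_comp _ _ c1 ck).
Qed.

(** The support lies over [a, b] in time; up to time b a translate of a function
    supported in a fixed square stays in a larger fixed square. *)
Lemma travelling_C1_compact : C1_compact f.
Proof.
have [dg1 cg1' [M1 hM1]] := hg1; have [dg2 cg2' [M2 hM2]] := hg2.
have cg1 := C1_line_continuous hg1; have cg2 := C1_line_continuous hg2.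
have cphi t : 0 < t -> {for t, continuous phi}.
  move=> t0; apply/differentiable_continuous/derivable1_diffP.
  by have [] := dphi t0.
split.
- by move=> z; rewrite inE; exact: travelling_differentiable.
- apply: (@eq_continuous_in _ _ _ (fun z => psi z.1 * tensor g1 g2 (ray z.2 (- q) z.1)
    - phi z.1 * (q.1 * tensor g1' g2 (ray z.2 (- q) z.1)
                 + q.2 * tensor g1 g2' (ray z.2 (- q) z.1)))).
  + exact: open_spacetime.
  + by move=> [t x]; rewrite inE => t0; exact: travelling_partial_t.
  + move=> z; rewrite inE => z0; apply: cvgB.
      apply: cvgM; first by apply: continuous_time; exact: cpsi.
      by apply: continuous_along; exact: continuous_tensor.
    apply: cvgM; first by apply: continuous_time; exact: cphi.
    by apply: cvgD; apply: cvgM; [exact: cvg_cst| |exact: cvg_cst|];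
      apply: continuous_along; exact: continuous_tensor.
- apply: (@eq_continuous_in _ _ _ (fun z => (phi z.1 * tensor g1' g2 (ray z.2 (- q) z.1),
    phi z.1 * tensor g1 g2' (ray z.2 (- q) z.1)))).
  + exact: open_spacetime.
  + move=> [t x]; rewrite inE => t0.
    rewrite [LHS]dot_pair !travelling_grad_x//.
    by congr (_ * _, _ * _); rewrite !mul1r !mul0r ?addr0 ?add0r.
  + move=> z; rewrite inE => z0.
    apply: (@continuous_pair _ R R (fun z => phi z.1 * tensor g1' g2 (ray z.2 (- q) z.1))
      (fun z => phi z.1 * tensor g1 g2' (ray z.2 (- q) z.1)) z);
      (apply: cvgM; first by apply: continuous_time; exact: cphi);
      by apply: continuous_along; exact: continuous_tensor.
(* on [a, b] the support has moved by at most b |q_i| *)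
- pose N := Num.max M1 M2 + b * (`|q.1| + `|q.2|).
  pose K : set (R * (R * R)) := `[a, b] `*` (`[- N, N] `*` `[- N, N]).
  have cK : compact K by do 2 (apply: compact_setX; try exact: segment_compact).
  have clK : closed K by apply: compact_closed => //; exact: norm_hausdorff.
  have fK : @spacetime R `&` [set z | f z != 0] `<=` K.
    move=> [t [x1 x2]] [/= t0].
    rewrite /f /travelling /= !mulf_eq0 !negb_or => /andP[ft /andP[h1 h2]].
    have tab : a <= t <= b.
      apply: contrapT => /negP; rewrite negb_and -!ltNge => tab.
      by move: ft; rewrite (phi0 t0 tab).1 eqxx.
    have y1 : `|x1 + t * - q.1| <= M1.
      by rewrite leNgt; apply: contra h1 => /hM1[-> _].
    have y2 : `|x2 + t * - q.2| <= M2.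
      by rewrite leNgt; apply: contra h2 => /hM2[-> _].
    have [ta tb] := andP tab.
    have qt (r : R) : `|t * - r| <= b * `|r|.
      by rewrite normrM normrN (gtr0_norm t0) ler_wpM2r.
    have := qt q.1; have := qt q.2.
    have z1 : `|x1| <= `|x1 + t * - q.1| + `|t * - q.1|.
      by rewrite -[X in `|X| <= _](addrK (t * - q.1)) ler_normB.
    have z2 : `|x2| <= `|x2 + t * - q.2| + `|t * - q.2|.
      by rewrite -[X in `|X| <= _](addrK (t * - q.2)) ler_normB.
    have m1 : M1 <= Num.max M1 M2 by rewrite le_max lexx.
    have m2 : M2 <= Num.max M1 M2 by rewrite le_max lexx orbT.
    have b0 : 0 <= b by rewrite (le_trans _ tb)// ltW.
    have [q1 q2] := (mulr_ge0 b0 (normr_ge0 q.1), mulr_ge0 b0 (normr_ge0 q.2)).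
    move=> u1 u2; split; first by rewrite /= in_itv.
    by split; rewrite /= in_itv/= -ler_norml /N mulrDr; lra.
  have clf : closure (@spacetime R `&` [set z | f z != 0]) `<=` K.
    by rewrite [X in _ `<=` X](closure_id K).1//; exact: closure_subset.
  rewrite setIidr; last first.
    by move=> z /clf [/=]; rewrite in_itv/= => /andP[/(lt_le_trans a0)].
  by apply: subclosed_compact clf => //; exact: closed_closure.
Qed.

End travelling_test.

Lemma continuous_within_halfline (R : realType) (F : R -> R) :
  {within [set t | 0 <= t], continuous F} -> forall t : R, 0 < t -> {for t, continuous F}.
Proof.
move=> cF t t0; have : {within [set t | 0 < t], continuous F}.
  by apply: continuous_subspaceW cF => u /ltW.
by rewrite continuous_open_subspace; [apply; rewrite inE|exact: open_gt].
Qed.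

Lemma integral_EFin_Rintegral d (T : measurableType d) (R : realType)
    (m : {measure set T -> \bar R}) (D : set T) (h : T -> R) :
  measurable D -> m.-integrable D (EFin \o h) ->
  (\int[m]_(x in D) (h x)%:E = (\int[m]_(x in D) h x)%:E)%E.
Proof. by move=> mD ih; rewrite /Rintegral fineK// integrable_fin_num. Qed.

(** The two drift contributions cancel after integration, leaving the moving-frame
    average of g1 (x) g2 against the time profile psi = phi'.  All pieces are
    continuous in t and supported in [a, b], so the extended integrals are
    finite and can be added. *)
Lemma weak_solution_travelling (R : realType) (alpha : R) (e q : R * R)
    (nu : R -> finite_borel R) (g1 g1' g2 g2' phi psi : R -> R) (a b : R) :
    weak_solution q alpha e nu -> C1_compact_line g1 g1' -> C1_compact_line g2 g2' ->
    0 < a ->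
    (forall t : R, 0 < t -> is_derive t (1 : R) phi (psi t)) ->
    (forall t : R, 0 < t -> {for t, continuous psi}) ->
    (forall t : R, 0 < t -> (t < a) || (b < t) -> phi t = 0 /\ psi t = 0) ->
  ((\int[lebesgue_measure]_(t in `[a, b])
      (psi t * \int[nu t]_x tensor g1 g2 (ray x (- q) t)))%R%:E +
   alpha%:E * \int[lebesgue_measure]_(t in `]0%R, +oo[)
      (travelling phi (tensor g1 g2) q (t, e))%:E = 0)%E.
Proof.
move=> [cnu _ nuE] hg1 hg2 a0 dphi cpsi phi0.
have [cs cs1 cs2] := compactly_supported_tensor hg1 hg2.
pose I h t := \int[nu t]_x h (ray x (- q) t).
have cI h t : compactly_supported h -> 0 < t -> {for t, continuous (I h)}.
  move=> ch t0; apply: continuous_within_halfline t0.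
  exact: continuous_shifted_integral.
have iI h t : compactly_supported h ->
    (nu t).-integrable setT (fun x => (h (ray x (- q) t))%:E).
  exact: compactly_supported_shift_integrable.
pose B t := q.1 * I (tensor g1' g2) t + q.2 * I (tensor g1 g2') t.
have iB t : (nu t).-integrable setT (fun x => (q.1 * tensor g1' g2 (ray x (- q) t) +
    q.2 * tensor g1 g2' (ray x (- q) t))%:E).
  exact: (integrableD measurableT (integrableZl measurableT q.1 (iI _ t cs1))
     (integrableZl measurableT q.2 (iI _ t cs2))).
have EB t : (\int[nu t]_x (q.1 * tensor g1' g2 (ray x (- q) t) +
    q.2 * tensor g1 g2' (ray x (- q) t)) = B t)%R.
  rewrite RintegralD//.
  - rewrite RintegralZl//; last exact: iI.
    rewrite RintegralZl//; last exact: iI.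
  - exact: (integrableZl measurableT q.1 (iI _ t cs1)).
  - exact: (integrableZl measurableT q.2 (iI _ t cs2)).
have := nuE _ (travelling_C1_compact q hg1 hg2 a0 dphi cpsi phi0).
have -> : (\int[lebesgue_measure]_(t in `]0%R, +oo[)
     \int[nu t]_x (partial_t (travelling phi (tensor g1 g2) q) (t, x))%:E =
   \int[lebesgue_measure]_(t in `]0%R, +oo[)
     (psi t * I (tensor g1 g2) t - phi t * B t)%:E)%E.
  apply: eq_integral => t; rewrite mem_setE in_itv/= andbT => t0.
  under eq_integral => x _ do rewrite (travelling_partial_t q hg1 hg2 dphi _ t0).
  have ia : (nu t).-integrable setT (fun x => (psi t * tensor g1 g2 (ray x (- q) t))%:E).
    exact: (integrableZl measurableT (psi t) (iI _ t cs)).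
  have ib : (nu t).-integrable setT
    (fun x => (phi t * (q.1 * tensor g1' g2 (ray x (- q) t) +
    q.2 * tensor g1 g2' (ray x (- q) t)))%:E).
    exact: (integrableZl measurableT (phi t) (iB t)).
  rewrite integral_EFin_Rintegral//; last exact: (integrableB measurableT ia ib).
  congr EFin; rewrite RintegralB//.
  congr (_ - _); first by rewrite RintegralZl//; exact: iI.
  by rewrite -EB; apply: RintegralZl => //; exact: iB.
have -> : (\int[lebesgue_measure]_(t in `]0%R, +oo[)
     \int[nu t]_x (dot q (grad_x (travelling phi (tensor g1 g2) q) (t, x)))%:E =
   \int[lebesgue_measure]_(t in `]0%R, +oo[) (phi t * B t)%:E)%E.
  apply: eq_integral => t; rewrite mem_setE in_itv/= andbT => t0.
  under eq_integral => x _ do rewrite (travelling_grad_x q hg1 hg2 dphi _ _ t0).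
  rewrite integral_EFin_Rintegral//;
    last exact: (integrableZl measurableT (phi t) (iB t)).
  by congr EFin; rewrite -EB; apply: RintegralZl => //; exact: iB.
have cphi t : 0 < t -> {for t, continuous phi}.
  move=> t0; apply/differentiable_continuous/derivable1_diffP.
  by have [] := dphi t t0.
have cA t : 0 < t -> {for t, continuous (fun t => psi t * I (tensor g1 g2) t)}.
  by move=> t0; apply: cvgM; [exact: cpsi|exact: cI].
have cB t : 0 < t -> {for t, continuous (fun t => phi t * B t)}.
  move=> t0; apply: cvgM; first exact: cphi.
  by apply: cvgD; apply: cvgM; [exact: cvg_cst|exact: cI|exact: cvg_cst|exact: cI].
have [|iA EA] := @integral_halfline R (fun t => psi t * I (tensor g1 g2) t) a b a0 cA.
  by move=> t t0 tab; rewrite (phi0 t t0 tab).2 mul0r.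
have [|iPB _] := @integral_halfline R (fun t => phi t * B t) a b a0 cB.
  by move=> t t0 tab; rewrite (phi0 t t0 tab).1 mul0r.
have iAB : lebesgue_measure.-integrable `]0%R, +oo[
    (fun t => (psi t * I (tensor g1 g2) t - phi t * B t)%:E).
  have h : lebesgue_measure.-integrable `]0%R, +oo[
    ((EFin \o (fun t => psi t * I (tensor g1 g2) t)%R) \-
     (EFin \o (fun t => phi t * B t)%R))%E by exact: integrableB.
  exact: h.
rewrite -integralD//.
under eq_integral => t _ do rewrite -EFinD subrK.
rewrite EA integral_EFin_Rintegral//.
apply: integrableS iA => //.
by move=> t /=; rewrite !in_itv/= andbT => /andP[/(lt_le_trans a0)].
Qed.

(** * The du Bois-Reymond lemma on the half-line *)

(** The primitive of F is monotone and vanishes at both ends, hence vanishes, and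
    so does its derivative F. *)
Lemma Rintegral_eq0_continuous (R : realType) (F : R -> R) (a b : R) :
    {within `[a, b], continuous F} -> (forall t, a <= t <= b -> 0 <= F t) ->
    \int[lebesgue_measure]_(t in `[a, b]) F t = 0 ->
  forall t, a < t < b -> F t = 0.
Proof.
move=> cF F0 intF t /andP[a_t tb].
have iF : lebesgue_measure.-integrable `[a, b] (EFin \o F).
  by apply: continuous_compact_integrable => //; exact: segment_compact.
have H0 u : a < u < b -> \int[lebesgue_measure]_(t in `[a, u]) F t = 0.
  move=> /andP[au ub].
  have sub : `[a, u] `<=` `[a, b] by apply: subset_itvl; rewrite bnd_simp ltW.
  apply/eqP; rewrite eq_le; apply/andP; split; last first.
    apply: Rintegral_ge0 => x /=; rewrite in_itv/= => /andP[ax xu].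
    by rewrite F0// ax (le_trans xu)// ltW.
  rewrite -intF -lee_fin -!integral_EFin_Rintegral//; last exact: integrableS iF.
  apply: ge0_subset_integral => //.
    by have /integrableP[] := iF.
have ct : {for t, continuous F}.
  have : {within `]a, b[, continuous F}.
    by apply: continuous_subspaceW cF => u /=; exact: subset_itv_oo_cc.
  rewrite continuous_open_subspace; last exact: interval_open.
  by apply; rewrite inE/= in_itv/= a_t.
have [_ <-] := continuous_FTC1_closed tb iF a_t ct.
rewrite derive1E; transitivity ('D_1 (cst (0 : R)) t); last exact: derive_cst.
apply: near_eq_derive.
near=> u; apply: H0; apply/andP; split; near: u.
  exact: lt_nbhsr.
exact: lt_nbhsl.
Unshelve. all: by end_near. Qed.

(** On ]a, b[ take psi = eta (G - c) with a positive weight eta and with c the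
    eta-average of G.  Then psi has integral zero, so its primitive is an admissible
    phi, and int psi G = int eta (G - c)^2, which must vanish: G = c on ]a, b[. *)
Lemma du_bois_reymond (R : realType) (G : R -> R) :
    {within [set t | 0 <= t], continuous G} ->
    (forall (phi psi : R -> R) (a b : R), 0 < a ->
      (forall t : R, 0 < t -> is_derive t (1 : R) phi (psi t)) ->
      (forall t : R, 0 < t -> {for t, continuous psi}) ->
      (forall t : R, 0 < t -> (t < a) || (b < t) -> phi t = 0 /\ psi t = 0) ->
      \int[lebesgue_measure]_(t in `[a, b]) (psi t * G t) = 0) ->
  forall t, 0 <= t -> G t = G 0.
Proof.
move=> cG hG.
have const (s t : R) : 0 < s -> s < t -> G s = G t.
  move=> s0 st; pose a := s / 2; pose b := t + 1.
  have a0 : 0 < a by rewrite divr_gt0.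
  have a_s : a < s by rewrite /a ltr_pdivrMr// ltr_pMr// ltr1n.
  have tb : t < b by rewrite ltrDl.
  have ab : a < b by rewrite (lt_trans a_s)// (lt_trans st).
  pose eta := hat a b.
  have ceta : continuous eta by exact: continuous_hat.
  have eta_ge0 u : 0 <= eta u by exact: hat_ge0.
  have eta_gt0 u : a < u < b -> 0 < eta u by exact: hat_gt0.
  have eta0 u : (u <= a) || (b <= u) -> eta u = 0.
    move=> uab; apply: hat_out; first exact: ltW.
    by rewrite in_itv/= negb_and -!leNgt.
  have subab : `[a, b] `<=` [set t | 0 <= t].
    by move=> u /=; rewrite in_itv/= => /andP[/(lt_le_trans a0)/ltW].
  have cGab : {within `[a, b], continuous G} by exact: continuous_subspaceW cG.
  have cpt (F : R -> R) u v : {within `[u, v], continuous F} ->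
      lebesgue_measure.-integrable `[u, v] (EFin \o F).
    by move=> cF; apply: continuous_compact_integrable => //; exact: segment_compact.
  have cw (F H : R -> R) (D : set R) :
      {within D, continuous F} -> {within D, continuous H} ->
      {within D, continuous (fun u => F u * H u)}.
    by move=> cF cH u; apply: cvgM; [exact: cF|exact: cH].
  have cetaD (D : set R) : {within D, continuous eta} by exact: continuous_subspaceT.
  have ieta := cpt _ a b (cetaD _).
  pose J := \int[lebesgue_measure]_(u in `[a, b]) eta u.
  have J0 : J != 0.
    apply/eqP => J0.
    have := Rintegral_eq0_continuous (cetaD _) (fun u _ => eta_ge0 u) J0.
    move=> /(_ s); rewrite a_s (lt_trans st tb) => /(_ isT) es.
    by have := eta_gt0 s; rewrite a_s (lt_trans st tb) es ltxx => /(_ isT).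
  (* the eta-average of G, so that psi below has integral zero *)
  pose c := (\int[lebesgue_measure]_(u in `[a, b]) (eta u * G u)) / J.
  pose psi u := eta u * (G u - c).
  have psi0 u : (u <= a) || (b <= u) -> psi u = 0.
    by move=> /eta0 e0; rewrite /psi e0 mul0r.
  have cpsiD (D : set R) : D `<=` [set t | 0 <= t] -> {within D, continuous psi}.
    move=> D0; apply: cw => // u; apply: cvgB; last exact: cvg_cst.
    by move: u; exact: continuous_subspaceW cG.
  have sub0 x : `[0, x] `<=` [set t : R | 0 <= t].
    by move=> u /=; rewrite in_itv/= => /andP[].
  have cpsi u : 0 < u -> {for u, continuous psi}.
    by move=> u0; apply: continuous_within_halfline u0; exact: cpsiD.
  pose phi x := \int[lebesgue_measure]_(u in `[0, x]) psi u.
  have intpsi : \int[lebesgue_measure]_(u in `[a, b]) psi u = 0.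
    rewrite /psi; under eq_Rintegral => u _ do rewrite mulrBr.
    have icst : lebesgue_measure.-integrable `[a, b] (fun u => (eta u * c)%:E).
      by apply: cpt; apply: cw => // u; exact: cvg_cst.
    rewrite RintegralB//; last by apply: cpt; exact: cw.
    by rewrite RintegralZr// /c mulrCA divff// mulr1 subrr.
  have dphi (u : R) : 0 < u -> is_derive u (1 : R) phi (psi u).
    move=> u0.
    have [] := @continuous_FTC1_closed R psi 0 u (u + 1) _ _ u0 (cpsi u u0).
    - by rewrite ltrDl.
    - by apply: cpt; exact: cpsiD.
    - by move=> dp; rewrite derive1E => <-; exact: DeriveDef.
  have phi0 (u : R) : 0 < u -> (u < a) || (b < u) -> phi u = 0 /\ psi u = 0.
    move=> u0 uab; split; last by apply: psi0; case/orP: uab => /ltW ->; rewrite ?orbT.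
    (* before a the primitive has not started, after b it has integrated psi entirely *)
    case/orP: uab => uab.
      transitivity (\int[lebesgue_measure]_(x in `[0, u]) (0 : R)); last first.
        by rewrite Rintegral_cst// mul0r.
      apply: eq_Rintegral => x; rewrite mem_setE in_itv/= => /andP[_ xu].
      by apply: psi0; rewrite (le_trans xu)// ltW.
    rewrite -[RHS]intpsi /phi Rintegral_mkcond [RHS]Rintegral_mkcond.
    congr Rintegral; apply/funext => x; rewrite !patchE !mem_setE !in_itv/=.
    have [ax|xa] := leP a x; last by case: ifP => // _; rewrite psi0// ltW.
    rewrite (le_trans (ltW a0) ax)/=.
    have [xb|bx] := leP x b; first by rewrite (le_trans xb)// ltW.
    by case: ifP => // _; rewrite psi0// (ltW bx) orbT.
  have := hG phi psi a b a0 dphi cpsi phi0 => psiG.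
  have sq : \int[lebesgue_measure]_(u in `[a, b]) (eta u * (G u - c) ^+ 2) = 0.
    transitivity (\int[lebesgue_measure]_(u in `[a, b]) (psi u * G u - psi u * c)).
      by apply: eq_Rintegral => u _; rewrite /psi; ring.
    have ipsi := cpt _ _ _ (cpsiD _ subab).
    rewrite RintegralB//; last 2 first.
    - by apply: cpt; apply: cw => //; exact: cpsiD.
    - apply: cpt; apply: cw; first exact: cpsiD.
      by move=> u; exact: cvg_cst.
    by rewrite psiG RintegralZr// intpsi mul0r subrr.
  have Gc u : a < u < b -> G u = c.
    move=> uab.
    have csq : {within `[a, b], continuous (fun u => eta u * (G u - c) ^+ 2)}.
      have cGc : {within `[a, b], continuous (fun u => G u - c)}.
        by move=> v; apply: cvgB; [exact: cGab|exact: cvg_cst].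
      exact: (cw _ _ _ (cetaD _) (cw _ _ _ cGc cGc)).
    have sq0 v : a <= v <= b -> 0 <= eta v * (G v - c) ^+ 2.
      by move=> _; rewrite mulr_ge0// sqr_ge0.
    have /eqP := Rintegral_eq0_continuous csq sq0 sq uab.
    rewrite mulf_eq0 gt_eqF ?eta_gt0//= sqrf_eq0 subr_eq0 => /eqP//.
  rewrite !Gc//; first by rewrite tb (lt_trans a_s).
  by rewrite a_s (lt_trans st).
move=> t; rewrite le_eqVlt => /predU1P[<- //|t0].
(* G is constant on ]0, oo[, and continuity carries the value to 0 *)
have G0 : G u @[u --> 0^'+] --> G 0.
  have /subspace_continuousP/(_ 0 (lexx _)) := cG.
  apply: cvg_trans; apply: cvg_app.
  by apply: within_subset => u /ltW.
have Gt : G u @[u --> 0^'+] --> G t.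
  apply: cvg_near_cst; near=> u; apply: const.
    by near: u; exact: nbhs_right_gt.
  by near: u; exact: nbhs_right_lt.
exact: (cvg_unique _ Gt G0).
Unshelve. all: by end_near. Qed.

(** * Uniqueness of weak solutions *)

(** The bumps are centred so that, after the shift to the moving frame, they
    converge to the indicator of the given rectangle; they are bounded by 1 and
    the measure is finite, so convergence is dominated. *)
Lemma cvg_integral_bump_rect (R : realType) (m : finite_borel R) (q : R * R)
    (t a b c d : R) : a <= b -> c <= d ->
  (\int[m]_x (tensor (C1_bump (a + t * q.1) (b + t * q.1) n)
                     (C1_bump (c + t * q.2) (d + t * q.2) n) (ray x q t))%:E)%E
    @[n --> \oo] --> m (`]a, b[ `*` `]c, d[).
Proof.
move=> ab cd.
have mrect : measurable (`]a, b[ `*` `]c, d[ : set (borel_plane R)).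
  by apply: measurable_open_rects; do 4 eexists.
have ab' : a + t * q.1 <= b + t * q.1 by rewrite lerD2r.
have cd' : c + t * q.2 <= d + t * q.2 by rewrite lerD2r.
pose g n (x : borel_plane R) : R := tensor (C1_bump (a + t * q.1) (b + t * q.1) n)
  (C1_bump (c + t * q.2) (d + t * q.2) n) (ray x q t).
have mg n : measurable_fun [set: borel_plane R] (g n).
  apply: continuous_borel_plane; apply: continuous_comp_shift; apply: continuous_tensor.
    by have [g' /C1_line_continuous] := @bump_C1 R (a + t * q.1) (b + t * q.1) n ab'.
  by have [g' /C1_line_continuous] := @bump_C1 R (c + t * q.2) (d + t * q.2) n cd'.
have g_cvg x : g n x @[n --> \oo] --> (\1_(`]a, b[ `*` `]c, d[) x : R).
  have E : \1_(`]a, b[ `*` `]c, d[) x =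
      \1_(`]a + t * q.1, b + t * q.1[%classic) (x.1 + t * q.1) *
      \1_(`]c + t * q.2, d + t * q.2[%classic) (x.2 + t * q.2) :> R.
    rewrite !indicE -natrM mulnb; congr (_%:R); congr (nat_of_bool _).
    rewrite !mem_setE !in_itv/= !ltrD2r.
    by apply/idP/idP; rewrite inE/= !in_itv => // /andP.
  by rewrite E; apply: cvgM; exact: cvg_bump.
have g_le1 n x : `|g n x| <= 1.
  rewrite /g /tensor normrM.
  have /andP[p0 p1] := @bump_ge0_le1 R (a + t * q.1) (b + t * q.1) n (ray x q t).1.
  have /andP[r0 r1] := @bump_ge0_le1 R (c + t * q.2) (d + t * q.2) n (ray x q t).2.
  by rewrite !ger0_norm// mulr_ile1.
have icst : m.-integrable setT (fun=> 1%:E).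
  apply: (@integrable_bounded_plane R m (fun=> 1) 1) => [x|x]; first exact: cvg_cst.
  by rewrite normr1.
have [|||||_ _] := @dominated_convergence _ (borel_plane R) R m setT measurableT
  (fun n x => (g n x)%:E) (fun x => (\1_(`]a, b[ `*` `]c, d[) x)%:E) (fun=> 1%:E).
- by move=> n; exact/measurable_EFinP.
- by apply/measurable_EFinP; exact: measurable_indic.
- by apply: aeW => x _; apply/fine_cvgP; split; [exact: nearW|exact: g_cvg].
- exact: icst.
- by apply: aeW => x n _; rewrite abse_EFin lee_fin.
by rewrite integral_indic// setIT.
Qed.

(** The source term is the same for both solutions and disappears in the
    difference. *)
Lemma weak_solution_unique (R : realType) (alpha : R) (e q : R * R)
    (nu1 nu2 : R -> finite_borel R) :
    weak_solution q alpha e nu1 -> weak_solution q alpha e nu2 ->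
  forall (t : R) A, 0 <= t -> measurable A -> nu1 t A = nu2 t A.
Proof.
move=> w1 w2 t A t0 mA.
have key (g1 g1' g2 g2' : R -> R) : C1_compact_line g1 g1' -> C1_compact_line g2 g2' ->
    \int[nu1 t]_x tensor g1 g2 (ray x (- q) t) =
    \int[nu2 t]_x tensor g1 g2 (ray x (- q) t).
  move=> hg1 hg2.
  have [cs _ _] := compactly_supported_tensor hg1 hg2.
  pose N (nu : R -> finite_borel R) u := \int[nu u]_x tensor g1 g2 (ray x (- q) u).
  have cN nu : weak_solution q alpha e nu -> {within [set t | 0 <= t], continuous (N nu)}.
    by move=> [cnu _ _]; exact: continuous_shifted_integral.
  have N0 nu : weak_solution q alpha e nu -> N nu 0 = 0.
    move=> [_ nu0 _]; rewrite /N /Rintegral (eq_measure_integral mzero); last first.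
      by move=> B mB _; exact: nu0.
    by rewrite integral_measure_zero.
  pose G u := N nu1 u - N nu2 u.
  have cG : {within [set t | 0 <= t], continuous G}.
    by move=> u; apply: cvgB; [exact: cN w1 u|exact: cN w2 u].
  have G00 : G 0 = 0 by rewrite /G !N0// subrr.
  suff : G t = G 0 by rewrite G00 => /eqP; rewrite subr_eq0 => /eqP.
  apply: (du_bois_reymond cG _ t0) => phi psi a b a0 dphi cpsi phi0.
  have := weak_solution_travelling w1 hg1 hg2 a0 dphi cpsi phi0.
  have := weak_solution_travelling w2 hg1 hg2 a0 dphi cpsi phi0.
  set c := (alpha%:E * _)%E.
  rewrite -/(N nu1) -/(N nu2) => e2 e1.
  have iN nu : weak_solution q alpha e nu ->
      lebesgue_measure.-integrable `[a, b] (EFin \o (fun u => psi u * N nu u)).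
    move=> w; apply: continuous_compact_integrable; first exact: segment_compact.
    apply/subspace_continuousP => u /=; rewrite in_itv/= => /andP[/(lt_le_trans a0) u0 _].
    apply: cvg_within_filter; apply: cvgM; first exact: cpsi.
    exact: continuous_within_halfline (cN _ w) _ u0.
  (* the common source term is finite, since its sum with a real is 0 *)
  have cfin : c \is a fin_num.
    by case: c e1 {e2}.
  move: e1 e2; rewrite -(fineK cfin) -!EFinD => -[e1] [e2].
  under eq_Rintegral => u _ do rewrite /G mulrBr.
  rewrite RintegralB//; [|exact: iN|exact: iN].
  by apply/eqP; rewrite subr_eq0 -(inj_eq (addIr (fine c))) e1 e2.
apply: finite_borel_eq => // a b c d.
(* degenerate rectangles are empty *)
have [ab|ba] := leP a b; last first.
  by rewrite set_itv_ge ?set0X ?measure0// bnd_simp -leNgt ltW.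
have [cd|dc] := leP c d; last first.
  by rewrite [X in _ `*` X]set_itv_ge ?setX0 ?measure0// bnd_simp -leNgt ltW.
pose h n := tensor (C1_bump (a + t * (- q).1) (b + t * (- q).1) n)
                   (C1_bump (c + t * (- q).2) (d + t * (- q).2) n).
have E n : (\int[nu1 t]_x (h n (ray x (- q) t))%:E =
             \int[nu2 t]_x (h n (ray x (- q) t))%:E)%E.
  have ab' : a + t * (- q).1 <= b + t * (- q).1 by rewrite lerD2r.
  have cd' : c + t * (- q).2 <= d + t * (- q).2 by rewrite lerD2r.
  have [g1' hg1] := @bump_C1 R _ _ n ab'; have [g2' hg2] := @bump_C1 R _ _ n cd'.
  have [cs _ _] := compactly_supported_tensor hg1 hg2.
  rewrite !integral_EFin_Rintegral//; try exact: compactly_supported_shift_integrable.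
  by congr EFin; exact: key hg1 hg2.
have := @cvg_integral_bump_rect R (nu1 t) (- q) t a b c d ab cd.
rewrite (funext E) => L1.
exact: (cvg_unique _ L1 (@cvg_integral_bump_rect R (nu2 t) (- q) t a b c d ab cd)).
Qed.

Theorem theorem3p1 (R : realType) (p1 p2 p3 p4 alpha : R) (e : R * R)
    (p1_gt0 : 0 < p1) (p2_gt0 : 0 < p2) (p3_gt0 : 0 < p3) (p4_gt0 : 0 < p4)
    (p_sum : p1 + p2 + p3 + p4 = 1)
    (drift_neq0 : `|p1 - p3| + `|p2 - p4| != 0)
    (alpha_gt0 : 0 < alpha)
    (e_lattice : exists h0 : R, 0 < h0 /\
       exists k1 k2 : int, e = (h0 * k1%:~R, h0 * k2%:~R)) :
  let q : R * R := (p1 - p3, p2 - p4) in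
  exists mu : R -> finite_borel R,
    [/\ forall (t : R) A, 0 <= t -> measurable A ->
          mu t A = (alpha%:E *
            \int[lebesgue_measure]_(s in `[0%R, t])
              \d_((e.1 + s * q.1, e.2 + s * q.2)%R : borel_plane R) A)%E,
        weak_solution q alpha e mu &
        forall nu : R -> finite_borel R, weak_solution q alpha e nu ->
          forall (t : R) A, 0 <= t -> measurable A -> nu t A = mu t A].
Proof.
move=> q; have a0 := ltW alpha_gt0.
have [mu muE] := @choice R (finite_borel R) _ (fun t => occupation_exists e q t a0).
have muw := occupation_weak_solution a0 muE.
exists mu; split => // [t A _ mA|nu nuw t A t0 mA].
  exact: (occupation_dirac (muE t) mA).
exact: weak_solution_unique nuw muw t A t0 mA.
Qed.
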